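(* Let $l_1(\Gamma, \alpha, \mathcal{A})$ be the set of all families $a = \{a_g\}_{g \in \Gamma}$ of elements of $\mathcal{A}$ such that $a_x \in \mathcal{A}\alpha_x(1)$ and $a_{-x} \in \alpha_x(1)\mathcal{A}$ for all $x \in \Gamma^+$, and $\sum_{g \in \Gamma} \|a_g\| < \infty$, with norm $\|a\| = \sum_{g}\|a_g\|$, pointwise addition and scalar multiplication, involution $(a^* )_g := a_{-g}^*$, and multiplication $$(a \cdot b)_g := \begin{cases} \sum_{\substack{g=x-y \\ x,y>0}} a_x \alpha_{x-y}(b_{-y}) + \sum_{\substack{g=y-x \\ x,y>0}} L_x(a_{-x} b_y) + \sum_{\substack{g=x+y \\ x,y \geq 0}} a_x \alpha_x(b_y), & \text{if } 0 \leq g, \\ \sum_{\substack{g=x-y \\ x,y>0}} \alpha_{y-x}(a_x) b_{-y} + \sum_{\substack{g=y-x \\ x,y>0}} L_y(a_{-x} b_y) + \sum_{\substack{g=-x-y \\ x,y \geq 0}} \alpha_y(a_{-x}) b_{-y}, & \text{if } g < 0, \end{cases}$$ where $x,y$ run through $\Gamma^+$. Then $l_1(\Gamma, \alpha, \mathcal{A})$ with these operations is a unital Banach *-algebra (with unit $1\delta_0$, the family equal to $1$ at $g=0$ and $0$ elsewhere).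
   Context: $\mathcal{A}$ is a C*-algebra with identity $1$, $\Gamma$ is a totally ordered abelian group with identity $0$ and positive cone $\Gamma^+ = \{x \in \Gamma: 0 \le x\}$, and $\alpha: \Gamma^+ \to \mathrm{End}(\mathcal{A})$ is a semigroup homomorphism ($\alpha_0 = \mathrm{Id}$, $\alpha_x\circ\alpha_y = \alpha_{x+y}$) by *-endomorphisms. The system $(\mathcal{A}, \Gamma^+, \alpha)$ is assumed finely representable, equivalently there is a (unique) complete transfer action $L$: continuous linear positive maps $L_x:\mathcal{A}\to\mathcal{A}$, $x\in\Gamma^+$, with $L_{x+y} = L_y \circ L_x$, $L_x(\alpha_x(a)b) = aL_x(b)$ and $\alpha_x(L_x(a)) = \alpha_x(1)a\alpha_x(1)$ for all $a,b\in\mathcal{A}$, $x,y\in\Gamma^+$. *)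

(* Defs.v *)
(* mathcomp + mathcomp-analysis + real-closed (complex numbers). *)
From HB Require Import structures.
From mathcomp Require Import all_boot all_order all_algebra.
From mathcomp Require Import all_classical all_reals all_analysis.
From mathcomp Require Import complex.
Set Implicit Arguments. Unset Strict Implicit. Unset Printing Implicit Defensive.
Import Order.TTheory GRing.Theory Num.Theory.
Local Open Scope ring_scope.
Local Open Scope classical_set_scope.

(* Unital C*-algebras over the complex numbers C := R[i] (R : realType). *)
(* The carrier is a complex vector space; multiplication, unit,          *)
(* involution and (real-valued) norm are given with the usual axioms,    *)
(* including completeness and the C*-identity.                           *)
Record cstar_algebra (R : realType) := CStarAlgebra {
  cs_car :> lmodType R[i];
  cs_mul : cs_car -> cs_car -> cs_car;
  cs_one : cs_car;
  cs_star : cs_car -> cs_car;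
  cs_norm : cs_car -> R;
  cs_mulA : forall a b c, cs_mul a (cs_mul b c) = cs_mul (cs_mul a b) c;
  cs_mul1l : forall a, cs_mul cs_one a = a;
  cs_mul1r : forall a, cs_mul a cs_one = a;
  cs_mulDl : forall a b c, cs_mul (a + b) c = cs_mul a c + cs_mul b c;
  cs_mulDr : forall a b c, cs_mul a (b + c) = cs_mul a b + cs_mul a c;
  cs_mulZl : forall (k : R[i]) a b, cs_mul (k *: a) b = k *: cs_mul a b;
  cs_mulZr : forall (k : R[i]) a b, cs_mul a (k *: b) = k *: cs_mul a b;
  cs_starK : forall a, cs_star (cs_star a) = a;
  cs_starD : forall a b, cs_star (a + b) = cs_star a + cs_star b;
  cs_starZ : forall (k : R[i]) a, cs_star (k *: a) = conjc k *: cs_star a;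
  cs_starM : forall a b, cs_star (cs_mul a b) = cs_mul (cs_star b) (cs_star a);
  cs_norm_eq0 : forall a, cs_norm a = 0 -> a = 0;
  cs_normD : forall a b, cs_norm (a + b) <= cs_norm a + cs_norm b;
  cs_normZ : forall (k : R[i]) a, cs_norm (k *: a) = Normc.normc k * cs_norm a;
  cs_normM : forall a b, cs_norm (cs_mul a b) <= cs_norm a * cs_norm b;
  cs_normC : forall a, cs_norm (cs_mul (cs_star a) a) = cs_norm a ^+ 2;
  cs_complete : forall u : nat -> cs_car,
    (forall e : R, 0 < e -> exists N : nat, forall m n : nat,
        (N <= m)%N -> (N <= n)%N -> cs_norm (u m - u n) < e) ->
    exists l : cs_car, forall e : R, 0 < e -> exists N : nat, forall n : nat,
        (N <= n)%N -> cs_norm (u n - l) < e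
}.

Section CStarDefs.
Variables (R : realType) (A : cstar_algebra R).
Local Notation "a * b" := (cs_mul a b) : ring_scope.
Local Notation "a ^*" := (cs_star a) : ring_scope.

(* positive elements of a C*-algebra: those of the form b^* b *)
Definition cs_positive (a : A) : Prop := exists b : A, a = b^* * b.

(* continuity (for the norm topology) of a map A -> A *)
Definition cs_continuous (f : A -> A) : Prop :=
  forall (a : A) (e : R), 0 < e -> exists d : R, 0 < d /\
    forall b : A, cs_norm (b - a) < d -> cs_norm (f b - f a) < e.

Definition cs_linear (f : A -> A) : Prop :=
  (forall a b, f (a + b) = f a + f b) /\ (forall (k : R[i]) a, f (k *: a) = k *: f a).

(* *-endomorphism (not necessarily unital) *)
Definition cs_star_endo (f : A -> A) : Prop :=
  [/\ cs_linear f, (forall a b, f (a * b) = f a * f b) & (forall a, f (a^*) = (f a)^*)].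

End CStarDefs.

(* Totally ordered abelian groups: a zmodType with a partial order (the  *)
(* [porderZmodType] join) which is total and translation invariant.      *)
(* Gamma^+ = [set x | 0 <= x].                                           *)
Definition totally_ordered_group (G : porderZmodType) : Prop :=
  (forall x y : G, x <= y \/ y <= x) /\
  (forall x y z : G, x <= y -> x + z <= y + z).

Section Dynamics.
Variables (R : realType) (A : cstar_algebra R) (G : porderZmodType).
Local Notation "a * b" := (cs_mul a b) : ring_scope.
Local Notation "a ^*" := (cs_star a) : ring_scope.
Local Notation "1" := (cs_one A) : ring_scope.

(* alpha : Gamma^+ -> End(A) semigroup homomorphism by *-endomorphisms;
   alpha is given on all of G but only its values on Gamma^+ matter. *)
Definition endo_semigroup_action (alpha : G -> A -> A) : Prop :=
  [/\ (forall x : G, 0 <= x -> cs_star_endo (alpha x)),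
      (forall a : A, alpha 0 a = a) &
      (forall x y : G, 0 <= x -> 0 <= y -> forall a : A,
          alpha x (alpha y a) = alpha (x + y) a)].

(* complete transfer action L for alpha (values on Gamma^+ only matter) *)
Definition complete_transfer_action (alpha L : G -> A -> A) : Prop :=
  forall x : G, 0 <= x ->
  [/\ cs_linear (L x) /\ cs_continuous (L x),
      (forall a : A, cs_positive a -> cs_positive (L x a)),
      (forall y : G, 0 <= y -> forall a : A, L (x + y) a = L y (L x a)),
      (forall a b : A, L x (alpha x a * b) = a * L x b) &
      (forall a : A, alpha x (L x a) = alpha x 1 * a * alpha x 1)].

(* ----- unconditional sums in A over arbitrary index sets ----- *)
(* [has_sum F S s]: the net of finite partial sums of F over finite
   subsets of S converges in norm to s. *)
Definition has_sum (T : choiceType) (F : T -> A) (S : set T) (s : A) : Prop :=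
  forall e : R, 0 < e -> exists X0 : set T,
    [/\ finite_set X0, X0 `<=` S &
        forall X : set T, finite_set X -> X0 `<=` X -> X `<=` S ->
          cs_norm ((\sum_(i \in X) F i) - s) < e].

Definition summable (T : choiceType) (F : T -> A) (S : set T) : Prop :=
  exists s : A, has_sum F S s.

(* the sum (0 if the series does not converge) *)
Definition gsum (T : choiceType) (F : T -> A) (S : set T) : A :=
  xget 0 [set s | has_sum F S s].

(* ----- the space l_1(Gamma, alpha, A) ----- *)
Definition l1_mem (alpha : G -> A -> A) (a : G -> A) : Prop :=
  [/\ (forall x : G, 0 <= x -> exists c : A, a x = c * alpha x 1),
      (forall x : G, 0 <= x -> exists c : A, a (- x) = alpha x 1 * c) &
      (\esum_(g in [set: G]) (cs_norm (a g))%:E < +oo)%E].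

Definition l1_norm (a : G -> A) : R := fine (\esum_(g in [set: G]) (cs_norm (a g))%:E)%E.

Definition l1_star (a : G -> A) : G -> A := fun g => (a (- g))^*.

Definition l1_one : G -> A := fun g => if g == 0 then 1 else 0.

(* index sets (pairs (x, y) of Gamma^+) of the three sums defining (a.b)_g *)
Definition idx1 (g : G) : set (G * G) :=
  [set p | 0 < p.1 /\ 0 < p.2 /\ g = p.1 - p.2].
Definition idx2 (g : G) : set (G * G) :=
  [set p | 0 < p.1 /\ 0 < p.2 /\ g = p.2 - p.1].
Definition idx3 (g : G) : set (G * G) :=
  if 0 <= g then [set p | 0 <= p.1 /\ 0 <= p.2 /\ g = p.1 + p.2]
  else [set p | 0 <= p.1 /\ 0 <= p.2 /\ g = - p.1 - p.2].

(* the corresponding terms *)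
Definition term1 (alpha : G -> A -> A) (a b : G -> A) (g : G) (p : G * G) : A :=
  if 0 <= g then a p.1 * alpha (p.1 - p.2) (b (- p.2))
  else alpha (p.2 - p.1) (a p.1) * b (- p.2).
Definition term2 (L : G -> A -> A) (a b : G -> A) (g : G) (p : G * G) : A :=
  if 0 <= g then L p.1 (a (- p.1) * b p.2)
  else L p.2 (a (- p.1) * b p.2).
Definition term3 (alpha : G -> A -> A) (a b : G -> A) (g : G) (p : G * G) : A :=
  if 0 <= g then a p.1 * alpha p.1 (b p.2)
  else alpha p.2 (a (- p.1)) * b (- p.2).

Definition l1_mul (alpha L : G -> A -> A) (a b : G -> A) : G -> A :=
  fun g => gsum (term1 alpha a b g) (idx1 g) + gsum (term2 L a b g) (idx2 g)
           + gsum (term3 alpha a b g) (idx3 g).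

(* all the series defining (a.b)_g converge *)
Definition l1_mul_defined (alpha L : G -> A -> A) (a b : G -> A) : Prop :=
  forall g : G, [/\ summable (term1 alpha a b g) (idx1 g),
                    summable (term2 L a b g) (idx2 g) &
                    summable (term3 alpha a b g) (idx3 g)].
End Dynamics.

(* Unital Banach *-algebra structure on a set M of families I -> A,      *)
(* with pointwise vector space operations, a given norm, product,        *)
(* involution and unit.                                                  *)
Section BanachStar.
Variables (R : realType) (A : cstar_algebra R) (I : Type).
Local Notation V := (I -> A).
Local Notation "a ^*" := (cs_star a) : ring_scope.
Definition fzero : V := fun _ => 0.
Definition fadd (a b : V) : V := fun i => a i + b i.
Definition fscale (k : R[i]) (a : V) : V := fun i => k *: a i.
Definition fsub (a b : V) : V := fun i => a i - b i.

Variables (M : set V) (nrm : V -> R) (mul : V -> V -> V) (star : V -> V) (one : V).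

Definition is_subspace : Prop :=
  [/\ M fzero, (forall a b, M a -> M b -> M (fadd a b)) &
      (forall k a, M a -> M (fscale k a))].

Definition is_norm : Prop :=
  [/\ (forall a, M a -> 0 <= nrm a),
      (forall a, M a -> nrm a = 0 -> a = fzero),
      (forall a b, M a -> M b -> nrm (fadd a b) <= nrm a + nrm b) &
      (forall k a, M a -> nrm (fscale k a) = Normc.normc k * nrm a)].

Definition is_complete : Prop :=
  forall u : nat -> V, (forall n, M (u n)) ->
    (forall e : R, 0 < e -> exists N : nat, forall m n : nat,
        (N <= m)%N -> (N <= n)%N -> nrm (fsub (u m) (u n)) < e) ->
    exists l : V, M l /\ forall e : R, 0 < e -> exists N : nat, forall n : nat,
        (N <= n)%N -> nrm (fsub (u n) l) < e.

Definition is_banach_algebra_mul : Prop :=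
  [/\ (forall a b, M a -> M b -> M (mul a b)),
      (forall a b c, M a -> M b -> M c -> mul a (mul b c) = mul (mul a b) c),
      (forall a b c, M a -> M b -> M c ->
          mul (fadd a b) c = fadd (mul a c) (mul b c) /\
          mul a (fadd b c) = fadd (mul a b) (mul a c)),
      (forall k a b, M a -> M b ->
          mul (fscale k a) b = fscale k (mul a b) /\
          mul a (fscale k b) = fscale k (mul a b)) &
      (forall a b, M a -> M b -> nrm (mul a b) <= nrm a * nrm b)].

Definition is_isometric_involution : Prop :=
  [/\ (forall a, M a -> M (star a)) /\
      (forall a, M a -> star (star a) = a),
      (forall a b, M a -> M b -> star (fadd a b) = fadd (star a) (star b)),
      (forall k a, M a -> star (fscale k a) = fscale (conjc k) (star a)),
      (forall a b, M a -> M b -> star (mul a b) = mul (star b) (star a)) &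
      (forall a, M a -> nrm (star a) = nrm a)].

Definition is_unit : Prop :=
  [/\ M one, (forall a, M a -> mul one a = a /\ mul a one = a) &
      nrm one = cs_norm (cs_one A)].

Definition unital_banach_star_algebra : Prop :=
  [/\ is_subspace /\ is_norm, is_complete, is_banach_algebra_mul,
      is_isometric_involution & is_unit].
End BanachStar.

(* Main.v *)
Require Import Defs.
From HB Require Import structures.
From mathcomp Require Import all_boot all_order all_algebra.
From mathcomp Require Import all_classical all_reals all_analysis.
From mathcomp Require Import complex ring lra.
Set Implicit Arguments. Unset Strict Implicit. Unset Printing Implicit Defensive.
Import Order.TTheory GRing.Theory Num.Theory.
Local Open Scope ring_scope.
Local Open Scope classical_set_scope.

(** A family [a] is thought of as the series of the monomials [a_g u_g] (g >= 0)
    and [u_{-g}^* a_g] (g < 0), where u_x a u_x^* = alpha_x(a) and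
    u_x^* a u_x = L_x(a).  All three sums of the product are pieces of one
    convolution  (a b)_k = sum_g twist g (k-g) a_g b_{k-g},  where [twist]
    multiplies the formal words u_x^* a u_y and then reduces them by
    u_{x+z}^* a u_{y+z} = u_x^* L_z(a) u_y.  Word multiplication is associative
    as in the bicyclic monoid, and reduction is compatible with it; so the
    algebraic identities hold on monomials, and extend to l_1 by density and
    continuity.

    Continuity rests on |alpha_x| <= 1 and |L_x| <= 1.  For a *-endomorphism f
    and a small self-adjoint a, the unitary a + i sqrt(1 - a^2) gives
    |f a| <= 1, hence a bound on f; the C*-identity for the powers a^(2^n)
    improves the bound to 1.  The same power argument applies to L_x, which is a
    continuous *-homomorphism on the corner alpha_x(1) A alpha_x(1). *)

Local Notation "a ** b" := (cs_mul a b) (at level 40, left associativity).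
Local Notation "a ^#" := (cs_star a) (at level 2, format "a ^#").

(** * Elementary algebra and norm estimates in a C*-algebra *)

Section CStarBasics.
Variables (R : realType) (A : cstar_algebra R).
Implicit Types (a b c : A) (f : A -> A).

Lemma cs_mul0l b : 0 ** b = 0 :> A.
Proof. by rewrite -(scale0r (0 : A)) cs_mulZl !scale0r. Qed.

Lemma cs_mul0r a : a ** 0 = 0.
Proof. by rewrite -(scale0r (0 : A)) cs_mulZr !scale0r. Qed.

Lemma cs_mulNl a b : (- a) ** b = - (a ** b).
Proof. by rewrite -scaleN1r cs_mulZl scaleN1r. Qed.

Lemma cs_mulNr a b : a ** (- b) = - (a ** b).
Proof. by rewrite -scaleN1r cs_mulZr scaleN1r. Qed.

Lemma cs_star0 : 0^# = 0 :> A.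
Proof. by rewrite -(scale0r (0 : A)) cs_starZ conjc0 !scale0r. Qed.

Lemma cs_starN a : (- a)^# = - a^#.
Proof. by apply/eqP; rewrite -addr_eq0 -cs_starD addNr cs_star0. Qed.

Lemma cs_star1 : (cs_one A)^# = cs_one A.
Proof. by rewrite -[LHS]cs_mul1l -{1}[cs_one A]cs_starK -cs_starM cs_mul1l cs_starK. Qed.

Lemma cs_norm0 : cs_norm (0 : A) = 0.
Proof. by rewrite -(scale0r (0 : A)) cs_normZ Normc.normc0 mul0r. Qed.

Lemma normc_real (r : R) : Normc.normc (r%:C)%C = `|r|.
Proof. by rewrite /= expr0n addr0 sqrtr_sqr. Qed.

Lemma cs_normZr (r : R) a : cs_norm ((r%:C)%C *: a) = `|r| * cs_norm a.
Proof. by rewrite cs_normZ normc_real. Qed.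

Lemma cs_normN a : cs_norm (- a) = cs_norm a.
Proof.
have -> : - a = ((-1 : R)%:C)%C *: a by rewrite rmorphN1 scaleN1r.
by rewrite cs_normZr normrN1 mul1r.
Qed.

Lemma cs_norm_ge0 a : 0 <= cs_norm a.
Proof. by have := cs_normD a (- a); rewrite subrr cs_norm0 cs_normN; lra. Qed.

Lemma cs_normBC a b : cs_norm (a - b) = cs_norm (b - a).
Proof. by rewrite -cs_normN opprB. Qed.

Lemma cs_normB_trans b a c :
  cs_norm (a - c) <= cs_norm (a - b) + cs_norm (b - c).
Proof. by have := cs_normD (a - b) (b - c); rewrite addrA subrK. Qed.

Lemma cs_norm_sum (I : Type) (s : seq I) (F : I -> A) :
  cs_norm (\sum_(i <- s) F i) <= \sum_(i <- s) cs_norm (F i).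
Proof.
elim: s => [|i s IH]; first by rewrite !big_nil cs_norm0.
by rewrite !big_cons (le_trans (cs_normD _ _))// lerD2l.
Qed.

(** The C*-identity gives |b|^2 <= |b^#| |b|; cancelling |b| leaves one inequality, and applying it
    to the adjoint gives the other. *)
Lemma cs_norm_star a : cs_norm a^# = cs_norm a.
Proof.
suff le b : cs_norm b <= cs_norm b^#.
  by apply/eqP; rewrite eq_le le andbT -{2}(cs_starK a) le.
have [b0|b0] := eqVneq (cs_norm b) 0; first by rewrite b0 cs_norm_ge0.
have b_gt0 : 0 < cs_norm b by rewrite lt_def b0 cs_norm_ge0.
by rewrite -(ler_pM2r b_gt0) -expr2 -cs_normC cs_normM.
Qed.

Lemma cs_norm_small_eq a b :
  (forall e : R, 0 < e -> cs_norm (a - b) < e) -> a = b.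
Proof.
move=> small; apply/eqP; rewrite -subr_eq0; apply/eqP/cs_norm_eq0/eqP.
rewrite eq_le cs_norm_ge0 andbT; apply/ler_addgt0Pl => e /small/ltW.
by rewrite addr0.
Qed.

(** By the C*-identity the norm of a projection equals its own square, so it is 0 or 1. *)
Lemma cs_projection_norm_le1 a : a^# = a -> a ** a = a -> cs_norm a <= 1.
Proof.
move=> sa aa; have := cs_normC a; rewrite sa aa => h.
have [->//|a0] := eqVneq (cs_norm a) 0; rewrite ?ler01//.
by have := mulfI a0 (etrans (mulr1 _) (etrans h (expr2 _))) => <-.
Qed.

Lemma cs_linear0 f : cs_linear f -> f 0 = 0.
Proof. by move=> [_ fZ]; rewrite -(scale0r (0 : A)) fZ !scale0r. Qed.

Lemma cs_linearN f a : cs_linear f -> f (- a) = - f a.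
Proof. by move=> [_ fZ]; rewrite -scaleN1r fZ scaleN1r. Qed.

Lemma cs_linearB f a b : cs_linear f -> f (a - b) = f a - f b.
Proof. by move=> fl; rewrite fl.1 cs_linearN. Qed.

Lemma cs_linear_sum (I : Type) (s : seq I) (F : I -> A) f : cs_linear f ->
  f (\sum_(i <- s) F i) = \sum_(i <- s) f (F i).
Proof. by move=> fl; apply: (big_morph f fl.1 (cs_linear0 fl)). Qed.

Lemma cs_linear_bounded f (d : R) : cs_linear f -> 0 < d ->
  (forall a, cs_norm a < d -> cs_norm (f a) <= 1) ->
  forall a, cs_norm (f a) <= (2 / d) * cs_norm a.
Proof.
move=> fl d0 fd a; have [a0|a0] := eqVneq (cs_norm a) 0.
  by rewrite (cs_norm_eq0 a0) (cs_linear0 fl) cs_norm0 mulr0.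
have a_gt0 : 0 < cs_norm a by rewrite lt_def a0 cs_norm_ge0.
(* Scales [a] to norm d/2, strictly inside the ball where [f] is controlled; hence the 2 in
   [2 / d]. *)
pose r := d / (2 * cs_norm a).
have r0 : 0 < r by rewrite divr_gt0// mulr_gt0.
have := fd ((r%:C)%C *: a); rewrite fl.2 !cs_normZr gtr0_norm//.
have -> : r * cs_norm a = d / 2 by rewrite /r; field.
have d2 : d / 2 < d by lra.
move=> /(_ d2) h; rewrite -(ler_pM2l r0) (le_trans h)//.
rewrite le_eqVlt; apply/orP; left; apply/eqP.
by rewrite /r; field; rewrite a0 gt_eqF.
Qed.

End CStarBasics.

(** * Contractivity of *-homomorphisms *)

Section Contractivity.
Variables (R : realType) (A : cstar_algebra R).
Implicit Types (a b c : A) (f : A -> A).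

(** If 0 < x < y, the powers of y / x grow beyond any [K] by Bernoulli's inequality. *)
Lemma ler_of_pow_bound (x y K : R) : 0 <= x -> 0 <= y ->
  (forall n, y ^+ (2 ^ n) <= K * x ^+ (2 ^ n)) -> y <= x.
Proof.
move=> x0 y0 bound; rewrite leNgt; apply/negP => xy.
have [x_eq0|x_neq0] := eqVneq x 0.
  by have := bound 0%N; rewrite x_eq0 expn0 !expr1 mulr0 leNgt -x_eq0 xy.
have x_gt0 : 0 < x by rewrite lt_def x_neq0.
pose t := y / x - 1.
have t0 : 0 < t by rewrite subr_gt0 ltr_pdivlMr// mul1r.
have bernoulli n : 1 + n%:R * t <= (1 + t) ^+ n.
  elim: n => [|n IH]; first by rewrite mul0r addr0 expr0.
  rewrite exprS -natr1; have n0 : 0 <= n%:R :> R by [].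
  have : (1 + t) * (1 + n%:R * t) <= (1 + t) * (1 + t) ^+ n.
    by rewrite ler_pM2l//; lra.
  by apply: le_trans; nra.
(* Chosen so that n t exceeds [K]; the exponent 2^n is larger still. *)
pose n := (Num.truncn (K / t)).+1.
have Kn : K < n%:R * t by rewrite -ltr_pdivrMr// truncnS_gt.
have {}Kn : K < (2 ^ n)%:R * t.
  by apply: (lt_trans Kn); rewrite ltr_pM2r// ltr_nat ltn_expl.
have := bound n; rewrite -ler_pdivrMr ?exprn_gt0// -expr_div_n.
have -> : y / x = 1 + t by rewrite /t addrC subrK.
move: (bernoulli (2 ^ n)%N); lra.
Qed.

(* For self-adjoint a the C*-identity gives |a^(2^n)| = |a|^(2^n), so the
   bound on f a^(2^n) improves to the constant 1 as n grows. *)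
Lemma bounded_star_morphism_contractive (S : set A) f (K : R) :
  (forall a b, S a -> S b -> S (a ** b)) -> (forall a, S a -> S a^#) ->
  (forall a b, S a -> S b -> f (a ** b) = f a ** f b) ->
  (forall a, S a -> f a^# = (f a)^#) ->
  (forall a, S a -> a^# = a -> cs_norm (f a) <= K * cs_norm a) ->
  forall a, S a -> cs_norm (f a) <= cs_norm a.
Proof.
move=> SM Sst fM fst bound.
have norm_sqr b : b^# = b -> cs_norm (b ** b) = cs_norm b ^+ 2.
  by move=> sb; rewrite -cs_normC sb.
have sa a : S a -> a^# = a -> cs_norm (f a) <= cs_norm a.
  move=> Sa sa; apply: (@ler_of_pow_bound _ _ K) => [||n]; try exact: cs_norm_ge0.
  pose sq b := b ** b.
  have h : [/\ S (iter n sq a), (iter n sq a)^# = iter n sq a,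
    cs_norm (iter n sq a) = cs_norm a ^+ (2 ^ n) &
    cs_norm (f (iter n sq a)) = cs_norm (f a) ^+ (2 ^ n)].
    elim: n => [|n [IS Isa In If]]; first by rewrite expn0 !expr1.
    rewrite iterS; split; first exact: SM.
    - by rewrite /sq cs_starM Isa.
    - by rewrite norm_sqr// In -exprM -expnSr.
    - by rewrite fM// norm_sqr ?If -?exprM -?expnSr// -fst// Isa.
  by case: h => IS Isa <- <-; exact: bound.
move=> a Sa; rewrite -(@ler_pXn2r _ 2)// ?nnegrE ?cs_norm_ge0//.
rewrite -!cs_normC -fst// -fM//; last exact: Sst.
by apply: sa; [apply: SM => //; exact: Sst | rewrite cs_starM cs_starK].
Qed.

(* The square root 1 - z of 1 - a^2 comes from the fixed point
   z = (a^2 + z^2) / 2 of a contraction of the ball of radius 1/2. *)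
Lemma sqrt_one_sub_sqr a : a^# = a -> cs_norm a <= 2^-1 ->
  exists y, [/\ y^# = y, y ** a = a ** y & y ** y = cs_one A - a ** a].
Proof.
move=> sa na; pose h : R[i] := ((2^-1 : R)%:C)%C.
have hC : conjc h = h by rewrite /h conjc_real.
have hn b : cs_norm (h *: b) = 2^-1 * cs_norm b.
  by rewrite cs_normZr ger0_norm// invr_ge0.
pose T z := h *: (a ** a + z ** z).
have naa : cs_norm (a ** a) <= 4^-1.
  by apply: le_trans (cs_normM _ _) _; have := cs_norm_ge0 a; nra.
have Tball z : cs_norm z <= 2^-1 -> cs_norm (T z) <= 2^-1.
  move=> nz; rewrite hn; have := cs_normD (a ** a) (z ** z).
  by have := cs_normM z z; have := cs_norm_ge0 z; nra.
have Tlip z w : cs_norm z <= 2^-1 -> cs_norm w <= 2^-1 ->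
    cs_norm (T z - T w) <= 2^-1 * cs_norm (z - w).
  move=> nz nw; rewrite -scalerBr hn opprD addrACA subrr add0r ler_pM2l//.
  have -> : z ** z - w ** w = z ** (z - w) + (z - w) ** w.
    by rewrite cs_mulDr cs_mulDl cs_mulNr cs_mulNl addrA subrK.
  apply: le_trans (cs_normD _ _) _.
  have := cs_normM z (z - w); have := cs_normM (z - w) w.
  by have := cs_norm_ge0 (z - w); nra.
pose z n := iter n T 0.
have zS n : z n.+1 = T (z n) by [].
have z_ball n : cs_norm (z n) <= 2^-1.
  by elim: n => [|n IH]; [rewrite cs_norm0 invr_ge0|rewrite zS Tball].
(* Both iterates are n-fold images under [T] of points at distance at most 1/2, namely [z m] and
   0. *)
have z_step m n : cs_norm (z (n + m)%N - z n) <= 2^-1 ^+ n.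
  elim: n => [|n IH].
    by rewrite subr0 expr0; apply: le_trans (z_ball _) _; lra.
  by rewrite addSn exprS (le_trans (Tlip _ _ (z_ball _) (z_ball _)))// ler_pM2l.
have half_small (e : R) : 0 < e -> exists N, 2^-1 ^+ N < e.
  move=> e0; exists (Num.truncn e^-1).+1.
  rewrite exprVn -[ltRHS]invrK ltf_pV2 ?posrE ?invr_gt0 ?exprn_gt0//.
  by apply: (lt_le_trans (truncnS_gt _)); rewrite -natrX ler_nat ltnW// ltn_expl.
have [l zl] : exists l : A, forall e : R, 0 < e -> exists N : nat,
    forall n : nat, (N <= n)%N -> cs_norm (z n - l) < e.
  apply: cs_complete => e e0; have [N Ne] := half_small (e / 2) ltac:(lra).
  exists N => m n Nm Nn; apply: le_lt_trans (cs_normB_trans (z N) _ _) _.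
  have := z_step (m - N)%N N; have := z_step (n - N)%N N.
  by rewrite !subnKC// (cs_normBC (z n)); lra.
have l_ball : cs_norm l <= 2^-1.
  apply/ler_addgt0Pl => e /zl[N /(_ N (leqnn N))].
  have := z_ball N; have := cs_normB_trans (z N) l 0.
  by rewrite !subr0 (cs_normBC l); lra.
have Tl : T l = l.
  apply: cs_norm_small_eq => e e0; have [N zN] := zl (e / 2) ltac:(lra).
  have := cs_normB_trans (z N.+1) (T l) l.
  have := Tlip _ _ l_ball (z_ball N); have := zN _ (leqnn N).
  have := zN _ (leqnSn N); rewrite (cs_normBC l).
  by rewrite !zS; lra.
(* Self-adjointness, and then commutation with [a], hold for every iterate and pass to the limit. *)
have sl : l^# = l.
  apply: cs_norm_small_eq => e e0; have [N zN] := zl (e / 2) ltac:(lra).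
  have szN : (z N)^# = z N.
    elim: N {zN} => [|n IH]; first by rewrite cs_star0.
    by rewrite zS cs_starZ cs_starD !cs_starM sa IH hC.
  have := cs_normB_trans (z N) l^# l.
  have -> : cs_norm (l^# - z N) = cs_norm (z N - l).
    by rewrite -cs_norm_star -cs_norm_star cs_starD cs_starN cs_starK szN cs_norm_star cs_normBC.
  by have := zN _ (leqnn N); lra.
have cl : l ** a = a ** l.
  apply: cs_norm_small_eq => e e0; have [N zN] := zl e e0.
  have czN : z N ** a = a ** z N.
    elim: N {zN} => [|n IH]; first by rewrite cs_mul0l cs_mul0r.
    rewrite zS cs_mulZl cs_mulZr cs_mulDl cs_mulDr -!cs_mulA.
    by rewrite IH !cs_mulA IH.
  have -> : l ** a - a ** l = (l - z N) ** a - a ** (l - z N).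
    rewrite cs_mulDl cs_mulDr cs_mulNl cs_mulNr czN opprD opprK.
    by rewrite addrACA addNr addr0.
  have := cs_normD ((l - z N) ** a) (- (a ** (l - z N))); rewrite cs_normN.
  have := cs_normM (l - z N) a; have := cs_normM a (l - z N).
  have := zN _ (leqnn N); rewrite cs_normBC.
  by have := cs_norm_ge0 (l - z N); have := cs_norm_ge0 a; nra.
exists (cs_one A - l); split.
- by rewrite cs_starD cs_starN cs_star1 sl.
- by rewrite cs_mulDl cs_mulDr cs_mulNl cs_mulNr cl cs_mul1l cs_mul1r.
(* This is the fixed-point equation doubled; it turns (1 - l)^2 = 1 - 2 l + l^2 into 1 - a^2. *)
have l2 : l + l = a ** a + l ** l.
  rewrite -{1 2}Tl -scalerDl.
  have -> : h + h = 1.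
    by apply/eqP; rewrite eq_complex /=; apply/andP; split; apply/eqP; field.
  by rewrite scale1r.
rewrite cs_mulDl cs_mul1l cs_mulNl cs_mulDr cs_mul1r cs_mulNr opprD opprK.
by rewrite addrA -[_ - l - l]addrA -opprD l2 opprD addrA subrK.
Qed.

(* With y = sqrt (1 - a^2), a is the real part of the unitary a + i y,
   and f sends unitaries to elements of norm at most 1. *)
Lemma star_endo_contractive f : cs_star_endo f ->
  forall a, cs_norm (f a) <= cs_norm a.
Proof.
move=> [fl fM fst] a0.
have n1 : cs_norm (f (cs_one A)) <= 1.
  by apply: cs_projection_norm_le1; rewrite -?fst ?cs_star1// -fM cs_mul1l.
have ball a : a^# = a -> cs_norm a < 2^-1 -> cs_norm (f a) <= 1.
  move=> sa /ltW na; have [y [sy ya yy]] := sqrt_one_sub_sqr sa na.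
  pose i : R[i] := ('i)%C.
  have iC : conjc i = - i by apply/eqP; rewrite eq_complex /= oppr0 !eqxx.
  have ii : i * i = -1.
    by apply/eqP; rewrite eq_complex /= !mul0r !mulr0 !mulr1 sub0r addr0 oppr0 !eqxx.
  pose u := a + i *: y.
  have su : u^# = a - i *: y by rewrite cs_starD cs_starZ sa sy iC scaleNr.
  have uu : u^# ** u = cs_one A.
    rewrite su /u cs_mulDl !cs_mulDr cs_mulNl cs_mulNl !cs_mulZl !cs_mulZr.
    rewrite scalerA ii yy ya scaleN1r opprK.
    by rewrite addrA addrK addrC subrK.
  have fu : cs_norm (f u) <= 1.
    by rewrite -(@ler_pXn2r _ 2)// ?nnegrE ?cs_norm_ge0// expr1n -cs_normC -fst -fM uu.
  (* Twice [a] is u + u^#, and both [f u] and its adjoint have norm at most 1. *)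
  have : f a + f a = f u + (f u)^#.
    by rewrite -fst su -!fl.1 /u addrACA subrr addr0.
  move/(congr1 (@cs_norm R A)); have := cs_normD (f u) (f u)^#.
  rewrite cs_norm_star -[f a + f a]/(f a *+ 2) -scaler_nat.
  have -> : (2 : R[i]) = ((2 : R)%:C)%C by rewrite rmorph_nat.
  by rewrite cs_normZr ger0_norm//; lra.
(* The constant 4 comes from rescaling to norm 1/4, inside the open ball of radius 1/2 where [ball]
   applies. *)
apply: (@bounded_star_morphism_contractive setT f 4) => // a _ sa.
have [na|na] := eqVneq (cs_norm a) 0.
  by rewrite (cs_norm_eq0 na) (cs_linear0 fl) cs_norm0 mulr0.
have a_gt0 : 0 < cs_norm a by rewrite lt_def na cs_norm_ge0.
pose r := (4 * cs_norm a)^-1.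
have r0 : 0 < r by rewrite invr_gt0 mulr_gt0.
have := ball ((r%:C)%C *: a).
rewrite cs_starZ conjc_real sa fl.2 !cs_normZr gtr0_norm//.
have -> : r * cs_norm a = 4^-1 by rewrite /r; field.
move=> /(_ erefl ltac:(lra)).
by rewrite mulrC ler_pdivrMr ?mulr_gt0// mul1r.
Qed.

End Contractivity.

(** * Positive parts in a totally ordered group *)

Section PositivePart.
Variable G : porderZmodType.
Hypothesis tot : totally_ordered_group G.
Implicit Types g h d x y z : G.

Lemma og_ge0_total g : 0 <= g \/ 0 <= - g.
Proof.
have [h|h] := tot.1 0 g; [by left|right].
by have := tot.2 _ _ (- g) h; rewrite subrr add0r.
Qed.

Lemma og_ge0_anti g : 0 <= g -> 0 <= - g -> g = 0.
Proof.
move=> g0 Ng0; apply: le_anti; rewrite g0 andbT.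
by have := tot.2 _ _ g Ng0; rewrite add0r addNr.
Qed.

Lemma og_addge0 g h : 0 <= g -> 0 <= h -> 0 <= g + h.
Proof. by move=> g0 h0; apply: le_trans h0 _; have := tot.2 _ _ h g0; rewrite add0r. Qed.

Definition pospart g := if 0 <= g then g else 0.

Lemma pospart_id g : 0 <= g -> pospart g = g.
Proof. by rewrite /pospart => ->. Qed.

Lemma pospart_eq0 g : 0 <= - g -> pospart g = 0.
Proof. by rewrite /pospart; case: ifPn => // g0 /(og_ge0_anti g0). Qed.

Lemma pospart_ge0 g : 0 <= pospart g.
Proof. by rewrite /pospart; case: ifPn. Qed.

Lemma pospart0 : pospart 0 = 0.
Proof. exact: pospart_id. Qed.

Lemma pospartB g : pospart g - pospart (- g) = g.
Proof.
have [g0|g0] := og_ge0_total g.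
  by rewrite pospart_id// pospart_eq0 ?opprK// subr0.
by rewrite pospart_eq0// pospart_id// sub0r opprK.
Qed.

(** The two sides will be the total shift of the leftmost word in a triple product under the two
    bracketings. Splitting on the sign of [d] reduces the identity to arithmetic. *)
Lemma pospart_comp d d' :
  pospart (- (d' + pospart d)) + pospart (- d) = pospart (pospart (- d') - d).
Proof.
have [d0|d0] := og_ge0_total d.
  rewrite (pospart_id d0) (@pospart_eq0 (- d)) ?opprK// addr0.
  have [d'0|d'0] := og_ge0_total d'; last by rewrite (pospart_id d'0) opprD.
  by rewrite (@pospart_eq0 (- d')) ?opprK// sub0r !pospart_eq0 ?opprK// og_addge0.
rewrite (pospart_eq0 d0) addr0 (pospart_id d0) [RHS]pospart_id//.
by rewrite og_addge0// pospart_ge0.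
Qed.

Lemma pospartE d : pospart d = pospart (- d) + d.
Proof. by rewrite -[X in _ + X]pospartB addrC subrK. Qed.

(** The same comparison for the middle word, deduced from [pospart_comp] through [pospartE]. *)
Lemma pospart_comp_mid d d' :
  pospart (- (d' + pospart d)) + pospart d
    = pospart (d - pospart (- d')) + pospart (- d').
Proof.
rewrite [X in _ + X = _]pospartE addrA pospart_comp.
by rewrite [pospart (_ - d)]pospartE opprB -addrA subrK.
Qed.

End PositivePart.

(** * The endomorphisms alpha_x, the projections alpha_x(1) and the transfer maps L_x *)

Section Action.
Variables (R : realType) (A : cstar_algebra R) (G : porderZmodType).
Variables alpha L : G -> A -> A.
Hypotheses (tot : totally_ordered_group G) (act : endo_semigroup_action alpha)
  (tr : complete_transfer_action alpha L).
Implicit Types (x y z g h : G) (a b c : A).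
Local Notation q x := (alpha x (cs_one A)).

Lemma alpha_linear x : 0 <= x -> cs_linear (alpha x).
Proof. by case: act => + _ _ => /[apply] -[]. Qed.

Lemma alphaM x a b : 0 <= x -> alpha x (a ** b) = alpha x a ** alpha x b.
Proof. by case: act => + _ _ => /[apply] -[]. Qed.

Lemma alpha_star x a : 0 <= x -> alpha x a^# = (alpha x a)^#.
Proof. by case: act => + _ _ => /[apply] -[]. Qed.

Lemma alpha0 a : alpha 0 a = a.
Proof. by case: act. Qed.

Lemma alpha_comp x y a : 0 <= x -> 0 <= y ->
  alpha x (alpha y a) = alpha (x + y) a.
Proof. by case: act => _ _ h x0 y0; exact: h. Qed.

Lemma alpha_norm x a : 0 <= x -> cs_norm (alpha x a) <= cs_norm a.
Proof. by move=> x0; apply: star_endo_contractive; case: act => /(_ _ x0). Qed.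

Lemma alpha1_star x : 0 <= x -> (q x)^# = q x.
Proof. by move=> x0; rewrite -alpha_star// cs_star1. Qed.

Lemma alpha1_idem x : 0 <= x -> q x ** q x = q x.
Proof. by move=> x0; rewrite -alphaM// cs_mul1l. Qed.

Lemma alpha1_norm x : 0 <= x -> cs_norm (q x) <= 1.
Proof. by move=> x0; apply: cs_projection_norm_le1; rewrite ?alpha1_star ?alpha1_idem. Qed.

Lemma transfer_linear x : 0 <= x -> cs_linear (L x).
Proof. by move=> /tr[] []. Qed.

Lemma transfer_comp x y a : 0 <= x -> 0 <= y -> L y (L x a) = L (x + y) a.
Proof. by move=> /tr[_ _ h _ _] y0; rewrite h. Qed.

Lemma transfer_alphal x a b : 0 <= x -> L x (alpha x a ** b) = a ** L x b.
Proof. by move=> /tr[_ _ _ h _]. Qed.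

Lemma alpha_transfer x a : 0 <= x -> alpha x (L x a) = q x ** a ** q x.
Proof. by move=> /tr[]. Qed.

(* A self-adjoint a satisfies 4 a = (a + 1)^2 - (a - 1)^2, a difference of
   positive elements. *)
Lemma transfer_star x a : 0 <= x -> L x a^# = (L x a)^#.
Proof.
move=> x0; have Ll := transfer_linear x0.
have pos_sa b : cs_positive b -> b^# = b.
  by move=> [c ->]; rewrite cs_starM cs_starK.
have L_sa b : b^# = b -> (L x b)^# = L x b.
  move=> sb; have LP c : (L x (c^# ** c))^# = L x (c^# ** c).
    by apply: pos_sa; case: (tr x0) => _ + _ _ _; apply; exists c.
  have sqD : (b + cs_one A) ** (b + cs_one A) = b ** b + cs_one A + (b + b).
    by rewrite cs_mulDl !cs_mulDr !cs_mul1l cs_mul1r [b + cs_one A]addrC addrACA.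
  have sqB : (b - cs_one A) ** (b - cs_one A) = b ** b + cs_one A - (b + b).
    rewrite cs_mulDl !cs_mulDr !cs_mulNl !cs_mulNr !cs_mul1l cs_mul1r opprK.
    by rewrite [- b + cs_one A]addrC addrACA opprD.
  have : (b + b) + (b + b) = (b + cs_one A)^# ** (b + cs_one A)
                             - (b - cs_one A)^# ** (b - cs_one A).
    rewrite !cs_starD cs_starN sb cs_star1 sqD sqB opprB.
    by rewrite [RHS]addrC [RHS]addrA subrK.
  move/(congr1 (L x)); rewrite (cs_linearB _ _ Ll) !Ll.1 => L4.
  have : ((L x b + L x b) + (L x b + L x b))^#
         = (L x b + L x b) + (L x b + L x b).
    by rewrite L4 cs_starD cs_starN !LP.
  have dbl c : c + c = (2 : R[i]) *: c by rewrite scaler_nat mulr2n.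
  rewrite !cs_starD !dbl !scalerA => /scalerI; apply.
  by rewrite mulf_neq0// pnatr_eq0.
pose h : R[i] := ((2^-1 : R)%:C)%C; pose i : R[i] := ('i)%C.
have iC : conjc i = - i by apply/eqP; rewrite eq_complex /= oppr0 !eqxx.
have ii : i * i = -1.
  by apply/eqP; rewrite eq_complex /= !mul0r !mulr0 !mulr1 sub0r addr0 oppr0 !eqxx.
have hC : conjc h = h by rewrite /h conjc_real.
have hh : h + h = 1.
  by apply/eqP; rewrite eq_complex /=; apply/andP; split; apply/eqP; field.
(* [u] and [v] are the real and imaginary parts of [a]; the self-adjoint case applies to each. *)
pose u := h *: (a + a^#); pose v := (- (i * h)) *: (a - a^#).
have su : u^# = u by rewrite cs_starZ hC cs_starD cs_starK addrC.
have sv : v^# = v.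
  have ihC : conjc (- (i * h)) = i * h.
    by apply/eqP; rewrite eq_complex /=; apply/andP; split; apply/eqP; ring.
  by rewrite cs_starZ ihC cs_starD cs_starN cs_starK [RHS]scaleNr -scalerN opprB addrC.
have av : a = u + i *: v.
  rewrite scalerA mulrN mulrA ii mulN1r opprK -scalerDr addrACA subrr addr0.
  by rewrite scalerDr -scalerDl hh scale1r.
rewrite [in LHS]av cs_starD cs_starZ su sv iC Ll.1 Ll.2.
by rewrite [in RHS]av Ll.1 Ll.2 cs_starD cs_starZ !L_sa// iC.
Qed.

(** The adjoint of [transfer_alphal], available since [L x] preserves the involution. *)
Lemma transfer_alphar x a b : 0 <= x -> L x (b ** alpha x a) = L x b ** a.
Proof.
move=> x0; apply: (can_inj (@cs_starK _ A)).
by rewrite -transfer_star// !cs_starM -alpha_star// transfer_alphal// transfer_star.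
Qed.

Lemma transfer0 a : L 0 a = a.
Proof. by rewrite -[LHS]alpha0 alpha_transfer// alpha0 cs_mul1l cs_mul1r. Qed.

(* L_x is multiplicative on the corner q_x A q_x. *)
Lemma transfer_norm x a : 0 <= x -> cs_norm (L x a) <= cs_norm a.
Proof.
move=> x0; have Ll := transfer_linear x0.
have [d [d0 Ld]] : exists d : R, 0 < d /\ forall b : A, cs_norm (b - 0) < d ->
    cs_norm (L x b - L x 0) < 1 by case: (tr x0) => -[_ +] _ _ _ _; apply.
pose S : set A := [set c | q x ** c ** q x = c].
have contr c : S c -> cs_norm (L x c) <= cs_norm c.
  apply: (@bounded_star_morphism_contractive _ _ S (L x) (2 / d)).
  - move=> b b' Sb Sb'; rewrite /S /= -{1}Sb -{1}Sb' !cs_mulA alpha1_idem// Sb.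
    by rewrite -[LHS]cs_mulA alpha1_idem// -!cs_mulA [q x ** (b' ** _)]cs_mulA Sb'.
  - by move=> b Sb; rewrite /S /= -[in RHS]Sb !cs_starM alpha1_star// cs_mulA.
  (* On the corner b = alpha_x(L_x(b)), so b leaves [L x] as a left factor. *)
  - by move=> b b' Sb _; rewrite -[in LHS]Sb -alpha_transfer// transfer_alphal.
  - by move=> b _; exact: transfer_star.
  (* Continuity at 0 with tolerance 1 supplies the radius [d], hence the bound [2 / d]. *)
  - move=> b _ _; apply: cs_linear_bounded => // b' b'd; apply/ltW.
    by have := Ld b'; rewrite (cs_linear0 Ll) !subr0; apply.
(* [L x] sees only the compression of [a] to the corner, and compressing does not increase the
   norm. *)
have -> : L x a = L x (q x ** a ** q x).
  by rewrite transfer_alphar// transfer_alphal// cs_mul1l cs_mul1r.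
apply: le_trans (contr _ _) _.
  by rewrite /S /= !cs_mulA alpha1_idem// -cs_mulA alpha1_idem.
have := cs_normM (q x ** a) (q x); have := cs_normM (q x) a.
have := alpha1_norm x0; have := cs_norm_ge0 a; have := cs_norm_ge0 (q x).
have := cs_norm_ge0 (q x ** a); nra.
Qed.

(** Here q_y = alpha_x(q_{y-x}), so the projections decrease as the index grows. *)
Lemma alpha1_mull x y : 0 <= x -> 0 <= y - x -> q x ** q y = q y.
Proof.
move=> x0 xy; rewrite -(subrK x y) addrC -alpha_comp// -alphaM//.
by rewrite cs_mul1l.
Qed.

Lemma alpha1_mulr x y : 0 <= x -> 0 <= y - x -> q y ** q x = q y.
Proof.
move=> x0 xy; rewrite -(subrK x y) addrC -alpha_comp// -alphaM//.
by rewrite cs_mul1r.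
Qed.

End Action.

(* [Mono x a y] stands for the formal product u_x^* a u_y, where u is the
   covariant family of partial isometries with u_x a u_x^* = alpha_x(a) and
   u_x^* a u_x = L_x(a). *)
Record mono (A G : Type) := Mono {src : G; coef : A; tgt : G}.

(** * Words u_x^* a u_y: product, reduction, normal form and the twist *)

Section Monomials.
Variables (R : realType) (A : cstar_algebra R) (G : porderZmodType).
Variables alpha L : G -> A -> A.
Hypotheses (tot : totally_ordered_group G) (act : endo_semigroup_action alpha)
  (tr : complete_transfer_action alpha L).
Implicit Types (x y z g h : G) (a b c : A) (X Y Z : mono A G).
Local Notation q x := (alpha x (cs_one A)).

(** Since u_x u_x^* = alpha_x(1), cutting a coefficient down by these projections does not change
    the word; validity selects the coefficient that is already cut down. *)
Definition mono_valid X := [/\ 0 <= src X, 0 <= tgt X,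
  q (src X) ** coef X = coef X & coef X ** q (tgt X) = coef X].

(** The bicyclic rule: where the words meet, the common exponent leaves a projection that valid
    coefficients absorb, and the excess moves outward past the neighbouring coefficient, acting on
    it by [alpha]. *)
Definition mono_mul X Y := let d := tgt X - src Y in
  Mono (src X + pospart (- d))
    (alpha (pospart (- d)) (coef X) ** alpha (pospart d) (coef Y))
    (tgt Y + pospart d).

Definition mono_red z X := Mono (src X - z) (L z (coef X)) (tgt X - z).

(** The minimum of the two exponents, so that [mono_nf] removes all they have in common. *)
Definition mono_min X := src X - pospart (src X - tgt X).

Definition mono_nf X := mono_red (mono_min X) X.

Definition mono_star X := Mono (tgt X) (coef X)^# (src X).

Lemma mono_minE X : mono_min X = tgt X - pospart (tgt X - src X).
Proof.
rewrite /mono_min [X in _ - X]pospartE// opprB opprD opprB.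
by rewrite [LHS]addrC -addrA subrK addrC.
Qed.

(** Comes down to comparing the exponents of [alpha] on the three coefficients: [eA], [eB] and [eC],
    from left to right. *)
Lemma mono_mulA X Y Z :
  mono_mul X (mono_mul Y Z) = mono_mul (mono_mul X Y) Z.
Proof.
rewrite /mono_mul /=; set d := tgt X - src Y; set d' := tgt Y - src Z.
have -> : tgt X - (src Y + pospart (- d')) = d - pospart (- d').
  by rewrite opprD addrA.
have -> : tgt Y + pospart d - src Z = d' + pospart d by rewrite addrAC.
have eA : pospart (- (d - pospart (- d'))) = pospart (- (d' + pospart d)) + pospart (- d).
  by rewrite pospart_comp// opprB.
have eB := pospart_comp_mid tot d d'.
(* The rightmost word mirrors the leftmost, with [d] and [d'] exchanged and negated. *)
have eC : pospart (d' + pospart d) = pospart (d - pospart (- d')) + pospart d'.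
  have := pospart_comp tot (- d') (- d); rewrite !opprK [pospart d + d']addrC => <-.
  by rewrite opprD opprK.
have p0 := @pospart_ge0 G.
congr Mono.
- by rewrite eA addrA addrAC.
- rewrite !alphaM// !alpha_comp// -cs_mulA eA eC.
  by congr (_ ** (alpha _ _ ** _)); rewrite eB.
- by rewrite eC -addrA [pospart d' + _]addrC.
Qed.

Lemma mono_mul_valid X Y : mono_valid X -> mono_valid Y -> mono_valid (mono_mul X Y).
Proof.
move=> [x0 x'0 qx _] [y0 y'0 _ qy]; have p0 := @pospart_ge0 G.
split; rewrite /= ?(og_addge0 tot)//.
  by rewrite addrC -alpha_comp// cs_mulA -alphaM// qx.
by rewrite [tgt Y + _]addrC -alpha_comp// -cs_mulA -alphaM// qy.
Qed.

Lemma mono_red_valid z X : 0 <= z -> 0 <= src X - z -> 0 <= tgt X - z ->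
  mono_valid X -> mono_valid (mono_red z X).
Proof.
move=> z0 xz yz [x0 y0 qx qy]; split=> //=.
  by rewrite -(transfer_alphal tr)// (alpha_comp act)// addrC subrK qx.
by rewrite -(transfer_alphar act tr)// (alpha_comp act)// addrC subrK qy.
Qed.

Lemma mono_star_mul X Y :
  mono_star (mono_mul X Y) = mono_mul (mono_star Y) (mono_star X).
Proof.
rewrite /mono_star /mono_mul /= -(opprB (tgt X)) opprK cs_starM.
by rewrite !alpha_star ?pospart_ge0.
Qed.

Lemma mono_star_red z X : 0 <= z ->
  mono_star (mono_red z X) = mono_red z (mono_star X).
Proof. by move=> z0; rewrite /mono_star /mono_red /= (transfer_star tr). Qed.

Lemma mono_starK X : mono_star (mono_star X) = X.
Proof. by case: X => x a y; rewrite /mono_star /= cs_starK. Qed.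

Lemma mono_star_valid X : mono_valid X -> mono_valid (mono_star X).
Proof.
by move=> [x0 y0 qx qy]; split=> //=;
  rewrite -{1}alpha1_star// -cs_starM ?qx ?qy.
Qed.

Lemma mono_min_ge0 X : 0 <= src X -> 0 <= tgt X -> 0 <= mono_min X.
Proof.
move=> x0 y0; have [d0|d0] := og_ge0_total tot (src X - tgt X).
  by rewrite /mono_min pospart_id// opprB addrC subrK.
by rewrite /mono_min pospart_eq0// subr0.
Qed.

Lemma mono_star_nf X : 0 <= src X -> 0 <= tgt X ->
  mono_star (mono_nf X) = mono_nf (mono_star X).
Proof.
move=> x0 y0; rewrite /mono_nf mono_star_red ?mono_min_ge0//.
by rewrite [in LHS]mono_minE.
Qed.

Lemma src_sub_min X : src X - mono_min X = pospart (src X - tgt X).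
Proof. by rewrite opprB addrC subrK. Qed.

Lemma tgt_sub_min X : tgt X - mono_min X = pospart (tgt X - src X).
Proof. by rewrite mono_minE opprB addrC subrK. Qed.

Lemma mono_nf_valid X : mono_valid X -> mono_valid (mono_nf X).
Proof.
move=> vX; have [x0 y0 _ _] := vX; apply: mono_red_valid => //.
- exact: mono_min_ge0.
- by rewrite src_sub_min pospart_ge0.
- by rewrite tgt_sub_min pospart_ge0.
Qed.

Lemma mono_red_red z w X : 0 <= z -> 0 <= w ->
  mono_red w (mono_red z X) = mono_red (z + w) X.
Proof. by move=> z0 w0; rewrite /mono_red /= (transfer_comp tr)// !opprD !addrA. Qed.

(** Reducing by [z] lowers the minimum by [z], and successive reductions add up. *)
Lemma mono_nf_red z X : 0 <= z -> 0 <= src X - z -> 0 <= tgt X - z ->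
  mono_nf (mono_red z X) = mono_nf X.
Proof.
move=> z0 xz yz; rewrite /mono_nf.
have zmin : z + mono_min (mono_red z X) = mono_min X.
  have e : src X - z - (tgt X - z) = src X - tgt X by rewrite opprB addrA subrK.
  by rewrite /mono_min /= e addrA [z + _]addrC subrK.
by rewrite mono_red_red// ?zmin// mono_min_ge0.
Qed.

(** The excess d - z is still nonnegative, and L_z(a) alpha_{d-z}(b) = L_z(a alpha_d(b)). *)
Lemma mono_mul_redl_ge z X Y : 0 <= z -> 0 <= tgt X - z - src Y ->
  mono_mul (mono_red z X) Y = mono_red z (mono_mul X Y).
Proof.
move=> z0; rewrite /mono_mul /= addrAC; set d := tgt X - src Y => dz.
have d0 : 0 <= d by rewrite -(subrK z d) (og_addge0 tot).
rewrite /mono_red /= (@pospart_eq0 _ tot (- d)) ?opprK//.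
rewrite (@pospart_eq0 _ tot (- (d - z))) ?opprK// !pospart_id//.
rewrite !addr0 !(alpha0 act) addrA; congr Mono.
by rewrite -(transfer_alphar act tr)// alpha_comp// [z + _]addrC subrK.
Qed.

(** The product shifts the reduced word by at least [z], and alpha_z(L_z(a)) = q_z a q_z, which is a
    by validity; so the reduction is undone. *)
Lemma mono_mul_redl_le z X Y : 0 <= z -> 0 <= src X - z -> 0 <= tgt X - z ->
  mono_valid X -> 0 <= src Y - tgt X ->
  mono_mul (mono_red z X) Y = mono_mul X Y.
Proof.
move=> z0 xz yz [_ _ qx qy] d0; rewrite /mono_mul /= [tgt X - z - _]addrAC.
set d := tgt X - src Y; have {}d0 : 0 <= - d by rewrite opprB.
have dz : 0 <= - (d - z) by rewrite opprD opprK (og_addge0 tot).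
rewrite !(pospart_eq0 _ d0)// !(pospart_eq0 _ dz)// !pospart_id// opprB.
rewrite addrA subrK; congr (Mono _ (_ ** _) _).
rewrite [z - d]addrC -alpha_comp// (alpha_transfer tr)//.
by rewrite -qx cs_mulA alpha1_mull// qx -qy -cs_mulA alpha1_mulr.
Qed.

Lemma mono_nf_mul_redl z X Y : 0 <= z -> 0 <= src X - z -> 0 <= tgt X - z ->
  mono_valid X -> mono_valid Y ->
  mono_nf (mono_mul (mono_red z X) Y) = mono_nf (mono_mul X Y).
Proof.
move=> z0 xz yz vX vY; have [x0 y0 qx qy] := vX; have p0 := @pospart_ge0 G.
have ge w : 0 <= w -> 0 <= src X - w -> 0 <= tgt X - w - src Y ->
    mono_nf (mono_mul (mono_red w X) Y) = mono_nf (mono_mul X Y).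
  move=> w0 xw dw; rewrite mono_mul_redl_ge// mono_nf_red//=.
    by rewrite addrAC (og_addge0 tot).
  have d0 : 0 <= tgt X - src Y by rewrite -(subrK w (tgt X - _)) (og_addge0 tot)// addrAC.
  rewrite pospart_id// -addrA (og_addge0 tot)//; first by case: vY.
  by rewrite addrAC.
have [dz|dz] := og_ge0_total tot (tgt X - z - src Y); first exact: ge.
have [d0|d0] := og_ge0_total tot (src Y - tgt X).
  by rewrite mono_mul_redl_le.
(* The source of [Y] lies between the reduced and the original target of [X]. Reducing by [w] stops
   exactly there; the remaining z - w falls under [mono_mul_redl_le]. *)
pose w := tgt X - src Y; have w0 : 0 <= w by rewrite /w -opprB.
have zw : 0 <= z - w by move: dz; rewrite addrAC opprB.
have xw : 0 <= src X - w.
  by rewrite -(subrK z (src X)) -addrA (og_addge0 tot).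
have yw : tgt X - w = src Y by rewrite opprB addrC subrK.
clearbody w.
rewrite -(subrK w z) [z - w + w]addrC -mono_red_red// -(ge w)//; last first.
  by rewrite yw subrr.
rewrite mono_mul_redl_le//=.
- by rewrite opprB addrA subrK.
- by rewrite opprB addrA subrK.
- apply: mono_red_valid => //; rewrite yw; by case: vY.
- by rewrite yw subrr.
Qed.

Lemma mono_nf_mul_nfl X Y : mono_valid X -> mono_valid Y ->
  mono_nf (mono_mul (mono_nf X) Y) = mono_nf (mono_mul X Y).
Proof.
move=> vX vY; have [x0 y0 _ _] := vX; apply: mono_nf_mul_redl => //.
- exact: mono_min_ge0.
- by rewrite src_sub_min pospart_ge0.
- by rewrite tgt_sub_min pospart_ge0.
Qed.

(** Obtained from the left version by adjoints, which reverse products and commute with normal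
    forms. *)
Lemma mono_nf_mul_nfr X Y : mono_valid X -> mono_valid Y ->
  mono_nf (mono_mul X (mono_nf Y)) = mono_nf (mono_mul X Y).
Proof.
move=> vX vY; apply: (can_inj mono_starK).
have [x0 x'0 _ _] := vX; have [y0 y'0 _ _] := vY.
have [n0 n'0 _ _] := mono_mul_valid vX (mono_nf_valid vY).
have [m0 m'0 _ _] := mono_mul_valid vX vY.
rewrite !mono_star_nf// !mono_star_mul mono_star_nf//.
by rewrite mono_nf_mul_nfl//; exact: mono_star_valid.
Qed.

Definition emb g a := Mono (pospart (- g)) a (pospart g).

Definition homog g a := mono_valid (emb g a).

(* The coefficient at g + h of the product of a at g and b at h. *)
Definition twist g h a b := coef (mono_nf (mono_mul (emb g a) (emb h b))).

(** The degree, target minus source, is additive under products and unchanged by reduction, and a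
    normal form is determined by its degree and coefficient. *)
Lemma emb_twist g h a b :
  mono_nf (mono_mul (emb g a) (emb h b)) = emb (g + h) (twist g h a b).
Proof.
rewrite /twist; set X := mono_mul _ _.
have -> : mono_nf X = Mono (pospart (src X - tgt X)) (coef (mono_nf X))
    (pospart (tgt X - src X)).
  by rewrite /mono_nf /mono_red src_sub_min tgt_sub_min.
rewrite /emb -(opprB (tgt X)) /=; set d := pospart g - _.
have E : pospart h + pospart d - (pospart (- g) + pospart (- d)) = g + h.
  rewrite opprD addrACA pospartB// [pospart h - _]addrC.
  by rewrite [LHS]addrC addrACA pospartB// [- _ + _]addrC pospartB.
by rewrite E.
Qed.

Lemma twist_homog g h a b : homog g a -> homog h b -> homog (g + h) (twist g h a b).
Proof.
by move=> ga hb; rewrite /homog -emb_twist; exact/mono_nf_valid/mono_mul_valid.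
Qed.

(** Take normal forms in [mono_mulA]; inner products may be normalised first. *)
Lemma twistA g h k a b c : homog g a -> homog h b -> homog k c ->
  twist g (h + k) a (twist h k b c) = twist (g + h) k (twist g h a b) c.
Proof.
move=> ga hb kc; have := congr1 mono_nf (mono_mulA (emb g a) (emb h b) (emb k c)).
rewrite -mono_nf_mul_nfr//; last exact: mono_mul_valid.
rewrite -[in RHS]mono_nf_mul_nfl//; last exact: mono_mul_valid.
by rewrite !emb_twist => -[].
Qed.

Lemma twist_star g h a b : (twist g h a b)^# = twist (- h) (- g) b^# a^#.
Proof.
rewrite /twist -[LHS]/(coef (mono_star _)) mono_star_nf ?mono_star_mul//=;
  rewrite ?(og_addge0 tot) ?pospart_ge0//.
by rewrite /mono_star /emb /= !opprK.
Qed.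

Lemma emb_star g a : mono_star (emb g a) = emb (- g) a^#.
Proof. by rewrite /emb opprK. Qed.

Lemma homog_star g a : homog g a -> homog (- g) a^#.
Proof. by rewrite /homog -emb_star; exact: mono_star_valid. Qed.

(** Six sign patterns, starting here, recover the terms of the product formula: three by direct
    computation, the others from these by [twist_star]. *)
Lemma twist_pospos g h a b : 0 <= g -> 0 <= h -> twist g h a b = a ** alpha g b.
Proof.
move=> g0 h0; rewrite /twist /= /mono_min /=.
have eg := pospart_id g0; have eh := pospart_id h0.
have eNg : pospart (- g) = 0 by rewrite pospart_eq0 ?opprK.
have eNh : pospart (- h) = 0 by rewrite pospart_eq0 ?opprK.
rewrite !(eNh, subr0, eg, eNg, eh) !add0r.
have -> : pospart (- (h + g)) = 0.
  by rewrite pospart_eq0// opprK (og_addge0 tot).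
by rewrite oppr0 (transfer0 act tr) alpha0.
Qed.

Lemma twist_negneg g h a b : 0 <= g -> 0 <= h ->
  twist (- g) (- h) a b = alpha h a ** b.
Proof.
move=> g0 h0; apply: (can_inj (@cs_starK _ A)).
by rewrite twist_star !opprK twist_pospos// cs_starM alpha_star.
Qed.

Lemma twist_posneg g h a b : 0 <= g -> 0 <= h -> 0 <= g - h ->
  twist g (- h) a b = a ** alpha (g - h) b.
Proof.
move=> g0 h0 gh; rewrite /twist /= /mono_min /= opprK.
have eg := pospart_id g0; have eh := pospart_id h0; have egh := pospart_id gh.
have eNg : pospart (- g) = 0 by rewrite pospart_eq0 ?opprK.
have eNh : pospart (- h) = 0 by rewrite pospart_eq0 ?opprK.
have eNgh : pospart (- (g - h)) = 0 by rewrite pospart_eq0 ?opprK.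
rewrite !(eg, eh, eNg, eNh, egh, eNgh) !add0r eNgh.
by rewrite oppr0 (transfer0 act tr) alpha0.
Qed.

Lemma twist_posneg_lt g h a b : 0 <= g -> 0 <= h -> 0 <= h - g ->
  twist g (- h) a b = alpha (h - g) a ** b.
Proof.
move=> g0 h0 gh; apply: (can_inj (@cs_starK _ A)).
by rewrite twist_star !opprK twist_posneg// cs_starM alpha_star.
Qed.

Lemma twist_negpos g h a b : 0 <= g -> 0 <= h -> 0 <= h - g ->
  twist (- g) h a b = L g (a ** b).
Proof.
move=> g0 h0 gh; rewrite /twist /= /mono_min /= opprK.
have eg := pospart_id g0; have eh := pospart_id h0.
have eNg : pospart (- g) = 0 by rewrite pospart_eq0 ?opprK.
have eNh : pospart (- h) = 0 by rewrite pospart_eq0 ?opprK.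
have egh : pospart (g - h) = 0 by rewrite pospart_eq0 ?opprB.
by rewrite !(eNg, eNh, eg, eh, subrr, oppr0, pospart0) !addr0 egh subr0 !alpha0.
Qed.

Lemma twist_negpos_lt g h a b : 0 <= g -> 0 <= h -> 0 <= g - h ->
  twist (- g) h a b = L h (a ** b).
Proof.
move=> g0 h0 gh; apply: (can_inj (@cs_starK _ A)).
by rewrite twist_star opprK twist_negpos// -(transfer_star tr)// cs_starM.
Qed.

(** Linearity and the norm bound rest on this shape, whose exponents do not depend on the
    coefficients. *)
Lemma twistE g h : exists z d d', [/\ 0 <= z, 0 <= d, 0 <= d' &
  forall a b, twist g h a b = L z (alpha d a ** alpha d' b)].
Proof.
pose d := pospart g - pospart (- h).
(* The exponents of a product ignore the coefficients, so 0 is a mere placeholder. *)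
exists (mono_min (mono_mul (emb g 0) (emb h 0))), (pospart (- d)), (pospart d).
split=> //; try exact: pospart_ge0.
by apply: mono_min_ge0; rewrite /= (og_addge0 tot)// pospart_ge0.
Qed.

Lemma twist_linearl g h b : cs_linear (fun a => twist g h a b).
Proof.
have [z [d [d' [z0 d0 d'0 tE]]]] := twistE g h.
have Ll := transfer_linear tr z0; have al := alpha_linear act d0.
by split=> *; rewrite !tE ?al.1 ?al.2 ?cs_mulDl ?cs_mulZl ?Ll.1 ?Ll.2.
Qed.

Lemma twist_linearr g h a : cs_linear (fun b => twist g h a b).
Proof.
have [z [d [d' [z0 d0 d'0 tE]]]] := twistE g h.
have Ll := transfer_linear tr z0; have al := alpha_linear act d'0.
by split=> *; rewrite !tE ?al.1 ?al.2 ?cs_mulDr ?cs_mulZr ?Ll.1 ?Ll.2.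
Qed.

Lemma twist_norm g h a b : cs_norm (twist g h a b) <= cs_norm a * cs_norm b.
Proof.
have [z [d [d' [z0 d0 d'0 ->]]]] := twistE g h.
apply: le_trans (transfer_norm act tr _ z0) _.
apply: le_trans (cs_normM _ _) _.
by rewrite ler_pM ?cs_norm_ge0// (alpha_norm act).
Qed.

End Monomials.

(** * Unconditional sums in a C*-algebra *)

Section UnconditionalSums.
Variables (R : realType) (A : cstar_algebra R).
Implicit Types T : choiceType.

(** Finite index sets are encoded, here and in [seq_sum], as duplicate-free lists, which are easy to
    concatenate, filter and map. *)
Definition sum_bounded T (N : T -> R) (C : R) :=
  forall r : seq T, uniq r -> \sum_(i <- r) N i <= C.

Definition seq_sum T (F : T -> A) (s : A) := forall e : R, 0 < e ->
  exists2 r0 : seq T, uniq r0 & forall r, uniq r -> {subset r0 <= r} ->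
    cs_norm (\sum_(i <- r) F i - s) < e.

(** Extension by 0 puts sums over different subsets on one index type, where they can be added. *)
Lemma has_sum_seq T (F : T -> A) (S : set T) s :
  has_sum F S s <-> seq_sum (fun i => if i \in S then F i else 0) s.
Proof.
split=> [h e /h[X0 [finX0 X0S X0e]]|h e /h[r0 ur0 r0e]].
  exists (finmap.enum_fset (fset_set X0)) => [|r ur sub]; first exact: finmap.fset_uniq.
  rewrite -big_mkcond -big_filter fsbig_seq ?filter_uniq//; apply: X0e => //.
    move=> i X0i /=; rewrite mem_filter mem_set ?sub//; last exact: X0S.
    by rewrite in_fset_set// mem_set.
  by move=> i /=; rewrite mem_filter => /andP[/set_mem].
exists [set` [seq i <- r0 | i \in S]]; split=> [//||X finX subX XS].
  by move=> i /=; rewrite mem_filter => /andP[/set_mem].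
(* Entries of [r0] outside [S] may be added freely, since their terms are 0. *)
pose r := undup (finmap.enum_fset (fset_set X) ++ r0).
have -> : X = [set` [seq i <- r | i \in S]].
  apply/seteqP; split=> i /=; rewrite mem_filter mem_undup mem_cat.
    by move=> Xi; rewrite in_fset_set// !mem_set//; exact: XS.
  case/andP=> Si /orP[|r0i]; first by rewrite in_fset_set// => /set_mem.
  by apply: subX; rewrite /= mem_filter Si.
rewrite -fsbig_seq ?filter_uniq ?undup_uniq// big_filter big_mkcond.
apply: r0e; first exact: undup_uniq.
by move=> i ri; rewrite mem_undup mem_cat ri orbT.
Qed.

Lemma seq_sum_ext T (F F' : T -> A) s : F =1 F' -> seq_sum F s -> seq_sum F' s.
Proof. by move=> FF'; rewrite (_ : F = F')//; exact/funext. Qed.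

Lemma seq_sum_unique T (F : T -> A) s s' : seq_sum F s -> seq_sum F s' -> s = s'.
Proof.
move=> Fs Fs'; apply: cs_norm_small_eq => e e0.
have [r ur re] := Fs (e / 2) ltac:(lra).
have [r' ur' re'] := Fs' (e / 2) ltac:(lra).
have ut := undup_uniq (r ++ r'); set t := undup _ in ut.
have := re t ut; have := re' t ut.
have := cs_normB_trans (\sum_(i <- t) F i) s s'.
rewrite [cs_norm (s - \sum_(_ <- _) _)]cs_normBC => h1 h2 h3.
have {}h2 : cs_norm (\sum_(i <- t) F i - s') < e / 2.
  by apply: h2 => i ri; rewrite mem_undup mem_cat ri orbT.
have {}h3 : cs_norm (\sum_(i <- t) F i - s) < e / 2.
  by apply: h3 => i ri; rewrite mem_undup mem_cat ri.
lra.
Qed.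

Lemma seq_sumD T (F F' : T -> A) s s' : seq_sum F s -> seq_sum F' s' ->
  seq_sum (fun i => F i + F' i) (s + s').
Proof.
move=> Fs Fs' e e0.
have [r ur re] := Fs (e / 2) ltac:(lra).
have [r' ur' re'] := Fs' (e / 2) ltac:(lra).
exists (undup (r ++ r')) => [|t ut sub]; first exact: undup_uniq.
rewrite big_split /= opprD addrACA.
apply: le_lt_trans (cs_normD _ _) _.
have h : cs_norm (\sum_(i <- t) F i - s) < e / 2.
  by apply: re => // i ri; apply: sub; rewrite mem_undup mem_cat ri.
have h' : cs_norm (\sum_(i <- t) F' i - s') < e / 2.
  by apply: re' => // i ri; apply: sub; rewrite mem_undup mem_cat ri orbT.
lra.
Qed.

Lemma seq_sum_linear T (F : T -> A) s (f : A -> A) (K : R) : cs_linear f ->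
  (forall a, cs_norm (f a) <= K * cs_norm a) ->
  seq_sum F s -> seq_sum (fun i => f (F i)) (f s).
Proof.
move=> fl fK Fs e e0; pose M := `|K| + 1.
have M0 : 0 < M by rewrite ltr_wpDl.
have [r ur re] := Fs (e / M) ltac:(exact: divr_gt0).
exists r => // t ut sub; rewrite -cs_linear_sum// -cs_linearB//.
apply: le_lt_trans (fK _) _; have := re t ut sub; rewrite ltr_pdivlMr//.
apply: le_lt_trans; rewrite mulrC ler_wpM2l ?cs_norm_ge0//.
by rewrite /M; have := ler_norm K; lra.
Qed.

Lemma seq_sum_single T (F : T -> A) j : (forall i, i != j -> F i = 0) ->
  seq_sum F (F j).
Proof.
move=> F0 e e0; exists [:: j] => // r ur /(_ j (mem_head _ _)) jr.
by rewrite (bigD1_seq j)//= big1// addr0 subrr cs_norm0.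
Qed.

(** Serves to turn the sums over pairs (x, y) into sums over the index of the left factor. *)
Lemma seq_sum_reindex T T' (F : T -> A) (F' : T' -> A) (S : set T')
    (to : T' -> T) (from : T -> T') s :
  (forall p, S p -> from (to p) = p) -> cancel from to ->
  (forall p, S p -> F' p = F (to p)) ->
  seq_sum (fun g => if from g \in S then F g else 0) s -> has_sum F' S s.
Proof.
move=> toK fromK FF' Fs; apply/has_sum_seq => e /Fs[r0 ur0 r0e].
exists (map from r0) => [|t ut sub]; first by rewrite map_inj_uniq//; exact: can_inj fromK.
pose t1 := map to [seq p <- t | p \in S].
have t1S g : g \in t1 -> from g \in S.
  by case/mapP=> p; rewrite mem_filter => /andP[Sp _] ->; rewrite toK//; exact: set_mem.
have ut1 : uniq t1.
  rewrite map_inj_in_uniq ?filter_uniq// => p p'.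
  rewrite !mem_filter => /andP[/set_mem Sp _] /andP[/set_mem Sp' _] pp'.
  by rewrite -(toK p)// pp' toK.
(* The leftover indices of [r0] contribute 0: were [from g] in [S], then g would already occur in
   [t1]. *)
pose r1 := t1 ++ [seq g <- r0 | g \notin t1].
have ur1 : uniq r1.
  rewrite cat_uniq ut1 filter_uniq// andbT; apply/hasPn => g.
  by rewrite mem_filter => /andP[].
have E : \sum_(g <- r1) (if from g \in S then F g else 0) =
    \sum_(p <- t) (if p \in S then F' p else 0).
  rewrite big_cat /= [X in _ + X]big_seq [X in _ + X]big1 ?addr0; last first.
    move=> g; rewrite mem_filter => /andP[gt1 gr0]; case: ifP => // Sg.
    case/negP: gt1; apply/mapP; exists (from g); last by rewrite fromK.
    by rewrite mem_filter Sg sub//; exact: map_f.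
  rewrite big_seq (eq_bigr F); last by move=> g /t1S ->.
  rewrite -big_seq big_map big_filter big_mkcond /=.
  by apply: eq_bigr => p _; case: ifP => // /set_mem Sp; rewrite FF'.
rewrite -E; apply: r0e => // g gr0.
by rewrite mem_cat mem_filter gr0 andbT orbN.
Qed.

(** Take [r0] whose sum is within e of the supremum; a disjoint list can then add less than e. *)
Lemma sum_bounded_tail T (N : T -> R) (C : R) : sum_bounded N C ->
  forall e, 0 < e -> exists2 r0, uniq r0 &
    forall r, uniq r -> ~~ has (mem r0) r -> \sum_(i <- r) N i < e.
Proof.
move=> NC e e0.
pose E := [set \sum_(i <- r) N i | r in [set r | uniq r]].
have supE : has_sup E.
  split; first by exists 0, [::]; rewrite ?big_nil.
  by exists C => _ [r ur <-]; exact: NC.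
have [_ [r0 /= ur0 <-] r0e] := sup_adherent e0 supE.
exists r0 => // r ur dis; have := sup_upper_bound supE.
move=> /(_ (\sum_(i <- r0 ++ r) N i)); rewrite big_cat /= => h.
have {}h : \sum_(i <- r0) N i + \sum_(i <- r) N i <= sup E.
  by apply: h; exists (r0 ++ r); rewrite /= ?cat_uniq ?ur0 ?ur ?dis// big_cat.
lra.
Qed.

Lemma seq_sum_exists T (F : T -> A) (C : R) :
  sum_bounded (fun i => cs_norm (F i)) C -> exists s, seq_sum F s.
Proof.
move=> FC.
(* Completeness concerns sequences, so the net of partial sums is sampled at the tolerances 1 / (n +
   1). *)
have [v [v0 small mono_inv]] : exists v : nat -> R, [/\ forall n, 0 < v n,
    forall e, 0 < e -> exists n, v n < e &
    forall m n, (n <= m)%N -> v m <= v n].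
  exists (fun n => n.+1%:R^-1); split=> [n|e e0|m n nm].
  - by rewrite invr_gt0.
  - exists (Num.truncn e^-1); rewrite -[ltRHS]invrK.
    by rewrite ltf_pV2 ?posrE ?invr_gt0// truncnS_gt.
  - by rewrite lef_pV2 ?posrE// ler_nat ltnS.
have tail n : exists r0, uniq r0 /\ forall r, uniq r -> {subset r0 <= r} ->
    cs_norm (\sum_(i <- r) F i - \sum_(i <- r0) F i) < v n.
  have [r0 ur0 r0n] := sum_bounded_tail FC (v0 n); exists r0; split=> // r ur sub.
  have -> : \sum_(i <- r) F i =
      \sum_(i <- r0) F i + \sum_(i <- r | i \notin r0) F i.
    rewrite (bigID (mem r0)) /=; congr (_ + _); rewrite -big_filter.
    apply: perm_big; apply: uniq_perm => //; first exact: filter_uniq.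
    by move=> i; rewrite mem_filter; case: (boolP (i \in r0)) => //= /sub.
  rewrite addrC addKr -big_filter; apply: le_lt_trans (cs_norm_sum _ _) _.
  apply: r0n; first exact: filter_uniq.
  by apply/hasPn => i; rewrite mem_filter => /andP[].
have [r rP] := choice tail; pose u n := \sum_(i <- r n) F i.
have [l ul] : exists l : A, forall e : R, 0 < e -> exists N : nat,
    forall n : nat, (N <= n)%N -> cs_norm (u n - l) < e.
  apply: cs_complete => e e0; have [k ke] := small (e / 2) ltac:(lra).
  exists k => m n km kn; pose t := undup (r m ++ r n).
  have ut : uniq t := undup_uniq _.
  have hm : cs_norm (\sum_(i <- t) F i - u m) < v m.
    by apply: (rP m).2 => // i ri; rewrite mem_undup mem_cat ri.
  have hn : cs_norm (\sum_(i <- t) F i - u n) < v n.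
    by apply: (rP n).2 => // i ri; rewrite mem_undup mem_cat ri orbT.
  have := cs_normB_trans (\sum_(i <- t) F i) (u m) (u n).
  by rewrite cs_normBC in hm; have := mono_inv _ _ km; have := mono_inv _ _ kn; lra.
exists l => e e0; have [k ke] := small (e / 2) ltac:(lra).
have [M uM] := ul (e / 2) ltac:(lra); pose n := maxn k M.
exists (r n) => [|t ut sub]; first exact: (rP n).1.
have := (rP n).2 t ut sub; have := uM n (leq_maxr _ _).
have := mono_inv _ _ (leq_maxl k M : (k <= n)%N).
by have := cs_normB_trans (u n) (\sum_(i <- t) F i) l; rewrite /u; lra.
Qed.

(** * The l_1 norm through finite partial sums *)

Section L1Norm.
Variable G : porderZmodType.
Implicit Types a b : G -> A.

Lemma esum_norm_le a (C : R) : sum_bounded (fun g => cs_norm (a g)) C ->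
  (\esum_(g in [set: G]) (cs_norm (a g))%:E <= C%:E)%E.
Proof.
move=> aC; apply: ge_ereal_sup => _ [X [finX _] <-].
by rewrite fsbig_finite//= sumEFin lee_fin; apply: aC; exact: finmap.fset_uniq.
Qed.

Lemma esum_norm_fin a (C : R) : sum_bounded (fun g => cs_norm (a g)) C ->
  (\esum_(g in [set: G]) (cs_norm (a g))%:E < +oo)%E.
Proof. by move=> /esum_norm_le/le_lt_trans; apply; exact: ltry. Qed.

Lemma esum_norm_ge0 a : (0 <= \esum_(g in [set: G]) (cs_norm (a g))%:E)%E.
Proof. by apply: esum_ge0 => g _; rewrite lee_fin cs_norm_ge0. Qed.

Lemma l1_norm_le a (C : R) : sum_bounded (fun g => cs_norm (a g)) C ->
  l1_norm a <= C.
Proof.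
move=> aC; rewrite -lee_fin /l1_norm fineK ?esum_norm_le//.
by rewrite ge0_fin_numE ?(esum_norm_fin aC) ?esum_norm_ge0.
Qed.

Lemma l1_norm_bounded a : (\esum_(g in [set: G]) (cs_norm (a g))%:E < +oo)%E ->
  sum_bounded (fun g => cs_norm (a g)) (l1_norm a).
Proof.
move=> afin r ur; rewrite -lee_fin /l1_norm fineK; last first.
  by rewrite ge0_fin_numE ?esum_norm_ge0.
by apply: esum_ge; exists [set` r]; [split | rewrite -fsbig_seq// sumEFin].
Qed.

End L1Norm.
End UnconditionalSums.

(** * The space l_1: homogeneous coefficients, vector operations, involution, completeness *)

Section L1Algebra.
Variables (R : realType) (A : cstar_algebra R) (G : porderZmodType).
Variables alpha L : G -> A -> A.
Hypotheses (tot : totally_ordered_group G) (act : endo_semigroup_action alpha)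
  (tr : complete_transfer_action alpha L).
Implicit Types (g h k : G) (a b c : G -> A) (s t : A).

Lemma homogP g s : homog alpha g s <->
  alpha (pospart (- g)) (cs_one A) ** s = s /\ s ** alpha (pospart g) (cs_one A) = s.
Proof. by split=> [[]//|[? ?]]; split=> //; exact: pospart_ge0. Qed.

Lemma homog0 g : homog alpha g 0.
Proof. by apply/homogP; rewrite cs_mul0l cs_mul0r. Qed.

Lemma homogD g s t : homog alpha g s -> homog alpha g t -> homog alpha g (s + t).
Proof.
move=> /homogP[s1 s2] /homogP[t1 t2]; apply/homogP.
by rewrite cs_mulDl cs_mulDr s1 s2 t1 t2.
Qed.

Lemma homogZ g z s : homog alpha g s -> homog alpha g (z *: s).
Proof. by move=> /homogP[s1 s2]; apply/homogP; rewrite cs_mulZl cs_mulZr s1 s2. Qed.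

Lemma homogN g s : homog alpha g s -> homog alpha g (- s).
Proof. by rewrite -scaleN1r; exact: homogZ. Qed.

(** Multiplication by the projection q is contractive, so the equations q t = t and t q = t pass to
    limits. *)
Lemma homog_closed g s :
  (forall e : R, 0 < e -> exists2 t, homog alpha g t & cs_norm (t - s) < e) ->
  homog alpha g s.
Proof.
move=> lim; apply/homogP; split; apply: cs_norm_small_eq => e e0;
  have [t /homogP[t1 t2] ts] := lim (e / 2) ltac:(lra).
  set q := alpha _ _; have q1 : cs_norm q <= 1 by apply: (alpha1_norm act); exact: pospart_ge0.
  have := cs_normB_trans t (q ** s) s; rewrite -{1}t1 -cs_mulNr -cs_mulDr.
  have := cs_normM q (s - t); have := cs_norm_ge0 (s - t); have := cs_norm_ge0 q.
  rewrite -(cs_normBC t s); nra.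
set q := alpha _ _; have q1 : cs_norm q <= 1 by apply: (alpha1_norm act); exact: pospart_ge0.
have := cs_normB_trans t (s ** q) s; rewrite -{1}t2 -cs_mulNl -cs_mulDl.
have := cs_normM (s - t) q; have := cs_norm_ge0 (s - t); have := cs_norm_ge0 q.
rewrite -(cs_normBC t s); nra.
Qed.

(** Lying in A q amounts to being fixed by right multiplication by the idempotent q; on the side
    where the positive part is 0, q is 1 and the condition is empty. *)
Lemma l1_memP a : l1_mem alpha a <-> (forall g, homog alpha g (a g)) /\
  (\esum_(g in [set: G]) (cs_norm (a g))%:E < +oo)%E.
Proof.
split=> [[pos neg afin]|[hom afin]]; split=> //.
- move=> g; apply/homogP; have [g0|g0] := og_ge0_total tot g.
    rewrite (pospart_eq0 tot) ?opprK// alpha0// cs_mul1l pospart_id//.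
    by have [c ->] := pos g g0; rewrite -cs_mulA alpha1_idem.
  rewrite (pospart_eq0 tot g0) alpha0// cs_mul1r pospart_id//.
  have [c] := neg _ g0; rewrite opprK => ->.
  by rewrite cs_mulA alpha1_idem.
- by move=> x x0; exists (a x); have /homogP[_] := hom x; rewrite pospart_id.
- move=> x x0; exists (a (- x)); have /homogP[+ _] := hom (- x).
  by rewrite opprK pospart_id.
Qed.

Lemma l1_mem_intro a (C : R) : (forall g, homog alpha g (a g)) ->
  sum_bounded (fun g => cs_norm (a g)) C -> l1_mem alpha a.
Proof. by move=> hom aC; apply/l1_memP; split=> //; exact: esum_norm_fin aC. Qed.

Lemma l1_mem_homog a g : l1_mem alpha a -> homog alpha g (a g).
Proof. by move=> /l1_memP[]. Qed.

Lemma l1_mem_bounded a : l1_mem alpha a ->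
  sum_bounded (fun g => cs_norm (a g)) (l1_norm a).
Proof. by move=> /l1_memP[_]; exact: l1_norm_bounded. Qed.

Lemma l1_norm_ge0 a : l1_mem alpha a -> 0 <= l1_norm a.
Proof. by move=> /l1_mem_bounded/(_ [::] isT); rewrite big_nil. Qed.

Lemma le_l1_norm a g : l1_mem alpha a -> cs_norm (a g) <= l1_norm a.
Proof. by move=> /l1_mem_bounded/(_ [:: g] isT); rewrite big_seq1. Qed.

Lemma l1_norm_eq0 a : l1_mem alpha a -> l1_norm a = 0 -> a = @fzero R A G.
Proof.
move=> am a0; apply/funext => g; apply/cs_norm_eq0/eqP.
by rewrite eq_le cs_norm_ge0 andbT -a0 le_l1_norm.
Qed.

Lemma fadd_bounded a b : l1_mem alpha a -> l1_mem alpha b ->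
  sum_bounded (fun g => cs_norm (fadd a b g)) (l1_norm a + l1_norm b).
Proof.
move=> /l1_mem_bounded aC /l1_mem_bounded bC r ur.
apply: le_trans (lerD (aC r ur) (bC r ur)).
by rewrite -big_split; apply: ler_sum => g _; exact: cs_normD.
Qed.

Lemma l1_mem_fadd a b : l1_mem alpha a -> l1_mem alpha b -> l1_mem alpha (fadd a b).
Proof.
move=> am bm; apply: l1_mem_intro (fadd_bounded am bm) => g.
by apply: homogD; exact: l1_mem_homog.
Qed.

Lemma l1_norm_fadd a b : l1_mem alpha a -> l1_mem alpha b ->
  l1_norm (fadd a b) <= l1_norm a + l1_norm b.
Proof. by move=> am bm; apply: l1_norm_le; exact: fadd_bounded. Qed.

Lemma fscale_bounded z a : l1_mem alpha a ->
  sum_bounded (fun g => cs_norm (fscale z a g)) (Normc.normc z * l1_norm a).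
Proof.
move=> /l1_mem_bounded aC r ur.
under eq_bigr do rewrite /fscale cs_normZ.
by rewrite -mulr_sumr ler_wpM2l ?aC//; case: z => x y; exact: sqrtr_ge0.
Qed.

Lemma l1_mem_fscale z a : l1_mem alpha a -> l1_mem alpha (fscale z a).
Proof.
move=> am; apply: l1_mem_intro (fscale_bounded z am) => g.
by apply: homogZ; exact: l1_mem_homog.
Qed.

Lemma l1_norm_fscale z a : l1_mem alpha a ->
  l1_norm (fscale z a) = Normc.normc z * l1_norm a.
Proof.
move=> am; apply/eqP; rewrite eq_le (l1_norm_le (fscale_bounded z am)) /=.
have [->|z0] := eqVneq z 0.
  by rewrite Normc.normc0 mul0r l1_norm_ge0//; exact: l1_mem_fscale.
have nz0 : 0 < Normc.normc z.
  rewrite lt_def; case: z z0 => x y z0; rewrite [_ <= _]sqrtr_ge0 andbT.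
  by apply: contra z0 => /eqP /Normc.eq0_normc ->.
(* For the reverse inequality, the bound just used is applied to the inverse scalar. *)
have -> : l1_norm a = l1_norm (fscale z^-1 (fscale z a)).
  by congr l1_norm; apply/funext => g; rewrite /fscale scalerA mulVf// scale1r.
rewrite mulrC -ler_pdivlMr// mulrC -Normc.normcV.
by apply: l1_norm_le; apply: fscale_bounded; exact: l1_mem_fscale.
Qed.

Lemma fsubE a b : fsub a b = fadd a (fscale (-1) b).
Proof. by apply/funext => g; rewrite /fadd /fscale scaleN1r. Qed.

Lemma l1_mem_fsub a b : l1_mem alpha a -> l1_mem alpha b -> l1_mem alpha (fsub a b).
Proof. by move=> am bm; rewrite fsubE; apply: l1_mem_fadd => //; exact: l1_mem_fscale. Qed.

Lemma l1_mem_fzero : l1_mem alpha (@fzero R A G).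
Proof.
apply: (@l1_mem_intro _ 0) => [g|r _]; first exact: homog0.
by rewrite big1// => g _; rewrite cs_norm0.
Qed.

Lemma star_bounded a : l1_mem alpha a ->
  sum_bounded (fun g => cs_norm (l1_star a g)) (l1_norm a).
Proof.
move=> am r ur; under eq_bigr do rewrite /l1_star cs_norm_star.
rewrite -(big_map -%R predT (fun g => cs_norm (a g))).
by apply: (l1_mem_bounded am); rewrite map_inj_uniq//; exact: oppr_inj.
Qed.

Lemma l1_starK a : l1_star (l1_star a) = a.
Proof. by apply/funext => g; rewrite /l1_star opprK cs_starK. Qed.

Lemma l1_mem_star a : l1_mem alpha a -> l1_mem alpha (l1_star a).
Proof.
move=> am; apply: l1_mem_intro (star_bounded am) => g.
by rewrite -{1}(opprK g); apply: (homog_star act); exact: l1_mem_homog.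
Qed.

Lemma l1_norm_star a : l1_mem alpha a -> l1_norm (l1_star a) = l1_norm a.
Proof.
move=> am; apply/eqP; rewrite eq_le (l1_norm_le (star_bounded am)) /=.
rewrite -{1}(l1_starK a); apply: l1_norm_le; apply: star_bounded.
exact: l1_mem_star.
Qed.

(** Limits are taken coordinatewise; the Cauchy estimate survives on each finite list, with a bound
    independent of the list. *)
Lemma l1_complete : is_complete [set a | l1_mem alpha a] (@l1_norm R A G).
Proof.
move=> u um cauchy.
have sub_mem m n : l1_mem alpha (fsub (u m) (u n)).
  by apply: l1_mem_fsub; exact: um.
have /choice[l ul] : forall g, exists s, forall e : R, 0 < e -> exists N : nat,
    forall n : nat, (N <= n)%N -> cs_norm (u n g - s) < e.
  move=> g.
  apply: (@cs_complete _ A (fun n => u n g)) => e /cauchy[N uN]; exists N => m n Nm Nn.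
  exact: le_lt_trans (le_l1_norm g (sub_mem m n)) (uN m n Nm Nn).
have ul_sum (r : seq G) (e : R) : 0 < e -> exists N : nat, forall n : nat,
    (N <= n)%N -> \sum_(g <- r) cs_norm (u n g - l g) < e.
  elim: r e => [|g r IH] e e0; first by exists 0%N => n _; rewrite big_nil.
  have [N1 h1] := ul g (e / 2) ltac:(lra); have [N2 h2] := IH (e / 2) ltac:(lra).
  exists (maxn N1 N2) => n; rewrite geq_max big_cons => /andP[/h1 ? /h2 ?]; lra.
have bound (e : R) : 0 < e -> exists N : nat, forall n : nat, (N <= n)%N ->
    sum_bounded (fun g => cs_norm (fsub (u n) l g)) e.
  move=> /cauchy[N uN]; exists N => n Nn r ur.
  apply/ler_addgt0Pl => e' /(ul_sum r)[M uM]; pose m := maxn N M.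
  have := uM m (leq_maxr _ _); have := uN n m Nn (leq_maxl _ _).
  have := l1_mem_bounded (sub_mem n m) ur.
  have : \sum_(g <- r) cs_norm (fsub (u n) l g) <=
      \sum_(g <- r) cs_norm (fsub (u n) (u m) g) + \sum_(g <- r) cs_norm (u m g - l g).
    by rewrite -big_split; apply: ler_sum => g _; exact: cs_normB_trans.
  lra.
have lm : l1_mem alpha l.
  have [N /(_ N (leqnn N)) bN] := bound 1 ltr01.
  (* The difference has norm at most 1 and homogeneous coefficients, so [l] inherits membership from
     [u N]. *)
  have -> : l = fsub (u N) (fsub (u N) l).
    by apply/funext => g; rewrite /fsub opprB addrC subrK.
  apply: l1_mem_fsub; first exact: um.
  apply: l1_mem_intro bN => g; apply: homogD; first exact/l1_mem_homog/um.
  apply: homogN; apply: homog_closed => e /(ul g)[M /(_ M (leqnn M)) uM].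
  by exists (u M g) => //; exact/l1_mem_homog/um.
exists l; split=> // e e0; have [N bN] := bound (e / 2) ltac:(lra).
exists N => n /bN /l1_norm_le; lra.
Qed.

(** * The product as a single convolution *)

Definition conv_term a b k g := twist alpha L g (k - g) (a g) (b (k - g)).

Lemma conv_term_bounded a b k : l1_mem alpha a -> l1_mem alpha b ->
  sum_bounded (fun g => cs_norm (conv_term a b k g)) (l1_norm a * l1_norm b).
Proof.
move=> am bm r ur.
have : \sum_(g <- r) cs_norm (a g) * l1_norm b <= l1_norm a * l1_norm b.
  by rewrite -mulr_suml ler_wpM2r ?l1_norm_ge0// l1_mem_bounded.
apply: le_trans; apply: ler_sum => g _; apply: le_trans (twist_norm tot act tr _ _ _ _) _.
by rewrite ler_wpM2l ?cs_norm_ge0// le_l1_norm.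
Qed.

Lemma gsumE (T : choiceType) (F : T -> A) (S : set T) s :
  has_sum F S s -> gsum F S = s.
Proof.
move=> Fs; have Fg : has_sum F S (gsum F S).
  by apply: (@xgetPex _ 0 [set s' | has_sum F S s']); exists s.
by apply: (@seq_sum_unique _ _ T); apply/has_sum_seq; first exact: Fg.
Qed.

Lemma og_gt0 g : (0 < g) = ~~ (0 <= - g).
Proof.
rewrite lt_def; have [g0|g0] := og_ge0_total tot g; rewrite g0 ?andbT /=.
  apply: congr1; apply/eqP/idP => [->|]; first by rewrite oppr0.
  exact: (og_ge0_anti tot).
by apply/andP => -[/eqP + g0']; apply; exact: (og_ge0_anti tot).
Qed.

(** The index sets split the group according to the signs of g and k - g: opposite strict signs for
    the first two sums, equal weak signs for the third. So the three sums add up to the whole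
    convolution. *)
Lemma l1_mul_sum a b k : l1_mem alpha a -> l1_mem alpha b ->
  [/\ Defs.summable (term1 alpha a b k) (idx1 k), Defs.summable (term2 L a b k) (idx2 k),
      Defs.summable (term3 alpha a b k) (idx3 k) &
      seq_sum (conv_term a b k) (l1_mul alpha L a b k)].
Proof.
move=> am bm; set F := conv_term a b k.
have part (P : pred G) : exists s, seq_sum (fun g => if P g then F g else 0) s.
  apply: (@seq_sum_exists _ _ _ _ (l1_norm a * l1_norm b)) => r ur.
  apply: le_trans (conv_term_bounded k am bm ur); apply: ler_sum => g _.
  by case: ifP => _; rewrite ?cs_norm0 ?cs_norm_ge0.
have kNg x y : k = x - y -> k - x = - y by move=> ->; rewrite addrAC subrr sub0r.
(* Each map recovers the pair (x, y) from [g], the index at which [a] is evaluated. *)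
pose from1 g := (g, g - k); pose from2 g := (- g, k - g).
pose from3 g := if 0 <= k then (g, k - g) else (- g, g - k).
have [s1 F1] := part (fun g => from1 g \in idx1 k).
have [s2 F2] := part (fun g => from2 g \in idx2 k).
have [s3 F3] := part (fun g => from3 g \in idx3 k).
have T1 : has_sum (term1 alpha a b k) (idx1 k) s1.
  apply: (seq_sum_reindex _ _ _ F1 (to := fst)) => // -[x y] [/= x0 [y0 kxy]].
    by rewrite /from1 kxy opprB addrC subrK.
  rewrite /F /conv_term /term1 /= (kNg x y)//; case: ifPn => k0.
    by rewrite (twist_posneg tot act tr) ?(ltW x0) ?(ltW y0) -?kxy.
  rewrite (twist_posneg_lt tot act tr) ?(ltW x0) ?(ltW y0)//.
  by rewrite -opprB -kxy; have [k0'|//] := og_ge0_total tot k; rewrite k0' in k0.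
have T2 : has_sum (term2 L a b k) (idx2 k) s2.
  apply: (seq_sum_reindex _ _ _ F2 (to := fun p => - p.1)) => [[x y]|g|[x y]].
  - by move=> [/= _ [_ kxy]]; rewrite /from2 /= kxy !opprK subrK.
  - by rewrite /= opprK.
  move=> [/= x0 [y0 kxy]].
  have kx : k + x = y by rewrite kxy subrK.
  rewrite /F /conv_term /term2 /= opprK kx; case: ifPn => k0.
    by rewrite (twist_negpos L tot act) ?(ltW x0) ?(ltW y0) -?kxy.
  rewrite (twist_negpos_lt tot act tr) ?(ltW x0) ?(ltW y0)//.
  by rewrite -opprB -kxy; have [k0'|//] := og_ge0_total tot k; rewrite k0' in k0.
have T3 : has_sum (term3 alpha a b k) (idx3 k) s3.
  move: F3; rewrite /from3 /idx3 /term3; case: ifPn => k0 F3.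
    apply: (seq_sum_reindex _ _ _ F3 (to := fst)) => // -[x y] [/= x0 [y0 kxy]].
      by rewrite kxy addrC addKr.
    rewrite /F /conv_term kxy [x + y]addrC addrK.
    by rewrite (twist_pospos tot act tr).
  apply: (seq_sum_reindex _ _ _ F3 (to := fun p => - p.1)) => [[x y]|g|[x y]].
  - by move=> [/= _ [_ ->]]; rewrite /= opprK opprD !opprK addrA addNr add0r.
  - by rewrite /= opprK.
  move=> [/= x0 [y0 kxy]].
  have kx : k - - x = - y by rewrite kxy opprK addrAC addNr add0r.
  by rewrite /F /conv_term kx (twist_negneg tot act tr).
split; [by exists s1|by exists s2|by exists s3|].
rewrite /l1_mul (gsumE T1) (gsumE T2) (gsumE T3).
apply: seq_sum_ext (seq_sumD (seq_sumD F1 F2) F3) => g /=.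
have i1 : (from1 g \in idx1 k) = ~~ (0 <= - g) && ~~ (0 <= k - g).
  rewrite -(opprB g) -!og_gt0; apply/idP/andP => [/set_mem[? []]//|[? ?]].
  by apply: mem_set; split=> //=; split=> //; rewrite opprB addrC subrK.
have i2 : (from2 g \in idx2 k) = ~~ (0 <= g) && ~~ (0 <= g - k).
  have -> : (0 <= g) = (0 <= - - g) by rewrite opprK.
  rewrite -(opprB k) -!og_gt0; apply/idP/andP => [/set_mem[? []]//|[? ?]].
  by apply: mem_set; split=> //=; split=> //; rewrite opprK subrK.
have i3 : (from3 g \in idx3 k) = if 0 <= k then (0 <= g) && (0 <= k - g)
    else (0 <= - g) && (0 <= g - k).
  rewrite /from3 /idx3; case: ifP => k0; apply/idP/andP.
  - by move=> /set_mem[? []].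
  - by move=> [? ?]; apply: mem_set; split=> //=; split=> //; rewrite addrC subrK.
  - by move=> /set_mem[? []].
  - move=> [? ?]; apply: mem_set; split=> //=; split=> //.
    by rewrite opprK opprB addrC subrK.
rewrite i1 i2 i3.
(* [pk] and [nk] settle the sign table at its boundary: for k >= 0, weakly negative g and k - g
   force k = g = 0, which the third sum still contains. *)
have pk : 0 <= g -> 0 <= k - g -> 0 <= k.
  by move=> g0 /(og_addge0 tot g0); rewrite addrC subrK.
have nk : 0 <= k -> 0 <= - g -> 0 <= g - k -> (0 <= g) && (0 <= k - g).
  move=> k0 g0 h0; have k0' : 0 <= - k.
    by have := og_addge0 tot g0 h0; rewrite addrA addNr add0r.
  have k_eq0 := og_ge0_anti tot k0 k0'; rewrite k_eq0 subr0 sub0r in h0 *.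
  by rewrite h0 g0.
have tg := og_ge0_total tot g; have th := og_ge0_total tot (k - g).
rewrite opprB in th; move: pk nk tg th.
case: (0 <= g); case: (0 <= - g); case: (0 <= k - g); case: (0 <= g - k);
  case: (0 <= k) => /= pk nk tg th;
  by [rewrite ?addr0 ?add0r | case: tg | case: th | have := pk isT isT
     | have := nk isT isT isT].
Qed.

Lemma l1_mul_seq_sum a b k : l1_mem alpha a -> l1_mem alpha b ->
  seq_sum (conv_term a b k) (l1_mul alpha L a b k).
Proof. by move=> am bm; case: (l1_mul_sum k am bm). Qed.

Lemma l1_mul_eq a b c : l1_mem alpha a -> l1_mem alpha b ->
  (forall k, seq_sum (conv_term a b k) (c k)) -> l1_mul alpha L a b = c.
Proof.
move=> am bm h; apply/funext => k.
exact: seq_sum_unique (l1_mul_seq_sum k am bm) (h k).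
Qed.

(** One list [t] serves all k in [r] at once, so that the two finite sums can be exchanged. *)
Lemma seq_sum_norm_finite (T : choiceType) (F : G -> T -> A) (s : G -> A)
    (r : seq G) (e : R) : (forall k, seq_sum (F k) (s k)) -> 0 < e ->
  exists2 t0 : seq T, uniq t0 & forall t : seq T, uniq t -> {subset t0 <= t} ->
    \sum_(k <- r) cs_norm (s k) <= \sum_(k <- r) \sum_(g <- t) cs_norm (F k g) + e.
Proof.
move=> Fs; elim: r e => [|k r IH] e e0.
  by exists [::] => // t _ _; rewrite !big_nil add0r ltW.
have [t1 ut1 h1] := Fs k (e / 2) ltac:(lra).
have [t2 ut2 h2] := IH (e / 2) ltac:(lra).
exists (undup (t1 ++ t2)) => [|t ut sub]; first exact: undup_uniq.
have {}h1 : cs_norm (\sum_(g <- t) F k g - s k) < e / 2.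
  by apply: h1 => // g gt; apply: sub; rewrite mem_undup mem_cat gt.
have {}h2 : \sum_(k <- r) cs_norm (s k) <=
    \sum_(k <- r) \sum_(g <- t) cs_norm (F k g) + e / 2.
  by apply: h2 => // g gt; apply: sub; rewrite mem_undup mem_cat gt orbT.
rewrite !big_cons; have := cs_norm_sum t (F k).
have := cs_normB_trans (\sum_(g <- t) F k g) (s k) 0.
rewrite !subr0 (cs_normBC (s k)); lra.
Qed.

(** After the exchange, for fixed g the norms of the translates b_{k-g} sum to at most the norm of
    b. *)
Lemma l1_mul_bounded a b : l1_mem alpha a -> l1_mem alpha b ->
  sum_bounded (fun k => cs_norm (l1_mul alpha L a b k)) (l1_norm a * l1_norm b).
Proof.
move=> am bm r ur; apply/ler_addgt0Pl => e e0.
have [t ut /(_ t ut (fun _ => id)) h] := seq_sum_norm_finite r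
  (fun k => l1_mul_seq_sum k am bm) e0.
rewrite addrC; apply: le_trans h _; rewrite lerD2r exchange_big /=.
have : \sum_(g <- t) cs_norm (a g) * l1_norm b <= l1_norm a * l1_norm b.
  by rewrite -mulr_suml ler_wpM2r ?l1_norm_ge0// l1_mem_bounded.
apply: le_trans; apply: ler_sum => g _.
have : \sum_(k <- r) cs_norm (a g) * cs_norm (b (k - g)) <= cs_norm (a g) * l1_norm b.
  rewrite -mulr_sumr ler_wpM2l ?cs_norm_ge0//.
  rewrite -(big_map (fun k => k - g) predT (fun k => cs_norm (b k))).
  by apply: (l1_mem_bounded bm); rewrite map_inj_uniq//; exact: addIr.
by apply: le_trans; apply: ler_sum => k _; exact: (twist_norm tot act tr).
Qed.

Lemma l1_mem_mul a b : l1_mem alpha a -> l1_mem alpha b ->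
  l1_mem alpha (l1_mul alpha L a b).
Proof.
move=> am bm; apply: l1_mem_intro (l1_mul_bounded am bm) => k.
(* Partial sums of the convolution are homogeneous of degree k, and homogeneity is a closed
   condition. *)
apply: homog_closed => e e0; have [r ur] := l1_mul_seq_sum k am bm e0.
move=> /(_ r ur (fun _ => id)); exists (\sum_(i <- r) conv_term a b k i) => //.
elim/big_ind: _ => [|s t|g _]; [exact: homog0|exact: homogD|].
rewrite -{1}(subrK g k) addrC; apply: (twist_homog tot act tr); exact: l1_mem_homog.
Qed.

Lemma l1_norm_mul a b : l1_mem alpha a -> l1_mem alpha b ->
  l1_norm (l1_mul alpha L a b) <= l1_norm a * l1_norm b.
Proof. by move=> am bm; apply: l1_norm_le; exact: l1_mul_bounded. Qed.

Lemma l1_mulDl a b c : l1_mem alpha a -> l1_mem alpha b -> l1_mem alpha c ->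
  l1_mul alpha L (fadd a b) c = fadd (l1_mul alpha L a c) (l1_mul alpha L b c).
Proof.
move=> am bm cm; apply: l1_mul_eq => // [|k]; first exact: l1_mem_fadd.
apply: seq_sum_ext (seq_sumD (l1_mul_seq_sum k am cm) (l1_mul_seq_sum k bm cm)).
by move=> g; rewrite /conv_term (twist_linearl tot act tr _ _ _).1.
Qed.

Lemma l1_mulDr a b c : l1_mem alpha a -> l1_mem alpha b -> l1_mem alpha c ->
  l1_mul alpha L a (fadd b c) = fadd (l1_mul alpha L a b) (l1_mul alpha L a c).
Proof.
move=> am bm cm; apply: l1_mul_eq => // [|k]; first exact: l1_mem_fadd.
apply: seq_sum_ext (seq_sumD (l1_mul_seq_sum k am bm) (l1_mul_seq_sum k am cm)).
by move=> g; rewrite /conv_term (twist_linearr tot act tr _ _ _).1.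
Qed.

Lemma seq_sumZ (T : choiceType) (F : T -> A) s (z : R[i]) :
  seq_sum F s -> seq_sum (fun i => z *: F i) (z *: s).
Proof.
apply: (@seq_sum_linear _ _ _ F s (fun s => z *: s) (Normc.normc z)).
  by split=> *; rewrite ?scalerDr// !scalerA mulrC.
by move=> t; rewrite cs_normZ.
Qed.

Lemma l1_mulZl z a b : l1_mem alpha a -> l1_mem alpha b ->
  l1_mul alpha L (fscale z a) b = fscale z (l1_mul alpha L a b).
Proof.
move=> am bm; apply: l1_mul_eq => // [|k]; first exact: l1_mem_fscale.
apply: seq_sum_ext (seq_sumZ z (l1_mul_seq_sum k am bm)).
by move=> g; rewrite /conv_term (twist_linearl tot act tr _ _ _).2.
Qed.

Lemma l1_mulZr z a b : l1_mem alpha a -> l1_mem alpha b ->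
  l1_mul alpha L a (fscale z b) = fscale z (l1_mul alpha L a b).
Proof.
move=> am bm; apply: l1_mul_eq => // [|k]; first exact: l1_mem_fscale.
apply: seq_sum_ext (seq_sumZ z (l1_mul_seq_sum k am bm)).
by move=> g; rewrite /conv_term (twist_linearr tot act tr _ _ _).2.
Qed.

(** * Monomials and extension of identities by density *)

Definition delta g s : G -> A := fun k => if k == g then s else 0.

Lemma delta_bounded g s : sum_bounded (fun k => cs_norm (delta g s k)) (cs_norm s).
Proof.
move=> r ur; have d0 k : k != g -> cs_norm (delta g s k) = 0.
  by move=> /negPf kg; rewrite /delta kg cs_norm0.
have [gr|gr] := boolP (g \in r).
  by rewrite (bigD1_seq g)//= big1// addr0 /delta eqxx.
rewrite big1_seq ?cs_norm_ge0// => k /andP[_ kr]; apply: d0.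
by apply: contraNneq gr => <-.
Qed.

Lemma l1_mem_delta g s : homog alpha g s -> l1_mem alpha (delta g s).
Proof.
move=> gs; apply: l1_mem_intro (delta_bounded g s) => k.
by rewrite /delta; case: eqP => [->|_]; [|exact: homog0].
Qed.

(** The convolution has at most one nonzero term, at the index g. *)
Lemma l1_mul_delta g h s t : homog alpha g s -> homog alpha h t ->
  l1_mul alpha L (delta g s) (delta h t) = delta (g + h) (twist alpha L g h s t).
Proof.
move=> gs ht; apply: l1_mul_eq => [||k]; try exact: l1_mem_delta.
have tl g' h' t' := cs_linear0 (twist_linearl tot act tr g' h' t').
have -> : delta (g + h) (twist alpha L g h s t) k
    = conv_term (delta g s) (delta h t) k g.
  rewrite /conv_term /delta eqxx; have [->|kgh] := eqVneq k (g + h).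
    by rewrite addrC addKr eqxx.
  rewrite subr_eq [h + g]addrC (negPf kgh).
  by rewrite (cs_linear0 (twist_linearr tot act tr _ _ _)).
by apply: seq_sum_single => g' /negPf g'g; rewrite /conv_term {1}/delta g'g tl.
Qed.

Lemma l1_star_delta g s : l1_star (delta g s) = delta (- g) s^#.
Proof.
apply/funext => k; rewrite /l1_star /delta eqr_oppLR.
by case: eqP; rewrite ?cs_star0.
Qed.

(** Split [a] into a finite sum of monomials, where [P] is at most 0, and a tail of small norm. *)
Lemma l1_dense_subadditive (P : (G -> A) -> R) (K : R) :
  (forall a b, l1_mem alpha a -> l1_mem alpha b -> P (fadd a b) <= P a + P b) ->
  (forall a, l1_mem alpha a -> P a <= K * l1_norm a) ->
  (forall g s, homog alpha g s -> P (delta g s) <= 0) ->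
  forall a, l1_mem alpha a -> P a <= 0.
Proof.
move=> PD PK P0 a am; apply/ler_addgt0Pl => e e0; rewrite addr0.
pose restr (Q : pred G) : G -> A := fun g => if Q g then a g else 0.
have restr_bound (Q : pred G) (r : seq G) :
    \sum_(g <- r) cs_norm (restr Q g) = \sum_(g <- [seq g <- r | Q g]) cs_norm (a g).
  rewrite big_filter [RHS]big_mkcond; apply: eq_bigr => g _.
  by rewrite /restr; case: ifP; rewrite ?cs_norm0.
have restr_mem Q : l1_mem alpha (restr Q).
  apply: (@l1_mem_intro _ (l1_norm a)) => [g|r ur].
    by rewrite /restr; case: ifP => _; [exact: l1_mem_homog|exact: homog0].
  by rewrite restr_bound; apply: (l1_mem_bounded am); exact: filter_uniq.
have finite_part (r : seq G) : uniq r -> P (restr (mem r)) <= 0.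
  elim: r => [_|g r IH /andP[gr ur]].
    (* The empty restriction is the zero family, seen as a monomial so that [P0] covers it. *)
    rewrite (_ : restr _ = delta 0 0); first exact/P0/homog0.
    by apply/funext => g; rewrite /restr /delta; case: ifP.
  have -> : restr (mem (g :: r)) = fadd (delta g (a g)) (restr (mem r)).
    apply/funext => k; rewrite /restr /fadd /delta /= inE.
    by have [->|_] /= := eqVneq; rewrite ?(negPf gr) ?addr0 ?add0r.
  have ga := l1_mem_homog g am.
  apply: le_trans (PD _ _ (l1_mem_delta ga) (restr_mem _)) _.
  by have := P0 _ _ ga; have := IH ur; lra.
(* Strictly positive whatever the sign of [K], so it can be divided by. *)
pose M := `|K| + 1; have M0 : 0 < M by rewrite ltr_wpDl.
have [r0 ur0 r0e] := sum_bounded_tail (l1_mem_bounded am) (divr_gt0 e0 M0).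
have tail : l1_norm (restr (predC (mem r0))) <= e / M.
  apply: l1_norm_le => r ur; rewrite restr_bound; apply/ltW/r0e.
    exact: filter_uniq.
  by apply/hasPn => g; rewrite mem_filter => /andP[].
have -> : a = fadd (restr (mem r0)) (restr (predC (mem r0))).
  apply/funext => g; rewrite /fadd /restr /=.
  by case: (g \in r0); rewrite ?addr0 ?add0r.
apply: le_trans (PD _ _ (restr_mem _) (restr_mem _)) _.
have := finite_part r0 ur0; have := PK _ (restr_mem (predC (mem r0))).
have n0 := l1_norm_ge0 (restr_mem (predC (mem r0))).
move: tail; rewrite ler_pdivlMr// /M; have := ler_norm K; nra.
Qed.

(** Additivity instead of linearity admits the conjugate-linear involution. *)
Definition bounded_additive (Phi : (G -> A) -> G -> A) := [/\
  forall a, l1_mem alpha a -> l1_mem alpha (Phi a),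
  forall a b, l1_mem alpha a -> l1_mem alpha b ->
    Phi (fadd a b) = fadd (Phi a) (Phi b) &
  exists2 K : R, 0 <= K & forall a, l1_mem alpha a -> l1_norm (Phi a) <= K * l1_norm a].

Lemma bounded_additive_id : bounded_additive id.
Proof. by split=> //; exists 1 => // a _; rewrite mul1r. Qed.

Lemma bounded_additive_comp Phi Psi : bounded_additive Phi ->
  bounded_additive Psi -> bounded_additive (fun a => Phi (Psi a)).
Proof.
move=> [Pm PD [K K0 PK]] [Qm QD [M M0 QM]]; split=> [a /Qm/Pm//|a b am bm|].
  by rewrite QD// PD//; exact: Qm.
exists (K * M) => [|a am]; first exact: mulr_ge0.
by apply: le_trans (PK _ (Qm _ am)) _; rewrite -mulrA ler_wpM2l// QM.
Qed.

Lemma bounded_additive_mull b : l1_mem alpha b ->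
  bounded_additive (fun a => l1_mul alpha L a b).
Proof.
move=> bm; split=> [a am|a c am cm|]; [exact: l1_mem_mul|exact: l1_mulDl|].
by exists (l1_norm b) => [|a am]; [exact: l1_norm_ge0|rewrite mulrC l1_norm_mul].
Qed.

Lemma bounded_additive_mulr a : l1_mem alpha a ->
  bounded_additive (fun b => l1_mul alpha L a b).
Proof.
move=> am; split=> [b bm|b c bm cm|]; [exact: l1_mem_mul|exact: l1_mulDr|].
by exists (l1_norm a) => [|b bm]; [exact: l1_norm_ge0|rewrite l1_norm_mul].
Qed.

Lemma l1_starD a b : l1_star (fadd a b) = fadd (l1_star a) (l1_star b).
Proof. by apply/funext => g; rewrite /l1_star /fadd cs_starD. Qed.

Lemma bounded_additive_star : bounded_additive (@l1_star R A G).
Proof.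
split=> [a|a b _ _|]; [exact: l1_mem_star|exact: l1_starD|].
by exists 1 => // a am; rewrite mul1r l1_norm_star.
Qed.

(** The norm of the difference is subadditive, bounded by K + M times the norm, and 0 on monomials;
    [l1_dense_subadditive] applies. *)
Lemma bounded_additive_eq Phi Psi :
  bounded_additive Phi -> bounded_additive Psi ->
  (forall g s, homog alpha g s -> Phi (delta g s) = Psi (delta g s)) ->
  forall a, l1_mem alpha a -> Phi a = Psi a.
Proof.
move=> [Pm PD [K K0 PK]] [Qm QD [M M0 QM]] PQ a am.
pose P c := l1_norm (fsub (Phi c) (Psi c)).
have subm c : l1_mem alpha c -> l1_mem alpha (fsub (Phi c) (Psi c)).
  by move=> cm; apply: l1_mem_fsub; [exact: Pm|exact: Qm].
have P_le0 : P a <= 0.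
  apply: (@l1_dense_subadditive P (K + M)) => // [b c bm cm|c cm|g s gs].
  - rewrite /P PD// QD//.
    have -> : fsub (fadd (Phi b) (Phi c)) (fadd (Psi b) (Psi c))
        = fadd (fsub (Phi b) (Psi b)) (fsub (Phi c) (Psi c)).
      by apply/funext => g; rewrite /fsub /fadd opprD addrACA.
    by apply: l1_norm_fadd; exact: subm.
  - rewrite /P fsubE; have Qc : l1_mem alpha (fscale (-1) (Psi c)).
      by apply: l1_mem_fscale; exact: Qm.
    apply: le_trans (l1_norm_fadd (Pm _ cm) Qc) _.
    rewrite l1_norm_fscale; last exact: Qm.
    have -> : Normc.normc (-1 : R[i]) = 1.
      by rewrite /= oppr0 expr0n addr0 sqrrN expr1n sqrtr1.
    by rewrite mul1r mulrDl lerD// ?PK ?QM.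
  - rewrite /P PQ// (_ : fsub _ _ = @fzero R A G).
      by apply: l1_norm_le => r _; rewrite big1// => h _; rewrite cs_norm0.
    by apply/funext => h; rewrite /fsub subrr.
have P0 : P a = 0 by apply/eqP; rewrite eq_le P_le0 l1_norm_ge0//; exact: subm.
have := l1_norm_eq0 (subm _ am) P0 => e0; apply/funext => g.
by apply/eqP; rewrite -subr_eq0; apply/eqP; exact: (congr1 (fun c => c g) e0).
Qed.

(** The variables are reduced to monomials one at a time, c, then b, then a, since each side is
    bounded and additive in each; [twistA] finishes. *)
Lemma l1_mulA a b c : l1_mem alpha a -> l1_mem alpha b -> l1_mem alpha c ->
  l1_mul alpha L a (l1_mul alpha L b c) = l1_mul alpha L (l1_mul alpha L a b) c.
Proof.
move=> am bm; move: c; apply: bounded_additive_eq.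
- by apply: bounded_additive_comp; exact: bounded_additive_mulr.
- by apply: bounded_additive_mulr; exact: l1_mem_mul.
move=> k t kt; have tm := l1_mem_delta kt; move: b bm; apply: bounded_additive_eq.
- apply: (bounded_additive_comp (bounded_additive_mulr am)).
  exact: bounded_additive_mull.
- apply: (bounded_additive_comp (bounded_additive_mull tm)).
  exact: bounded_additive_mulr.
move=> h s hs; have sm := l1_mem_delta hs; move: a am; apply: bounded_additive_eq.
- by apply: bounded_additive_mull; exact: l1_mem_mul.
- exact: (bounded_additive_comp (bounded_additive_mull tm) (bounded_additive_mull sm)).
move=> g r gr; rewrite !l1_mul_delta// ?addrA ?(twistA tot act tr)//;
  exact: (twist_homog tot act tr).
Qed.

Lemma l1_starM a b : l1_mem alpha a -> l1_mem alpha b ->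
  l1_star (l1_mul alpha L a b) = l1_mul alpha L (l1_star b) (l1_star a).
Proof.
move=> am; move: b; apply: bounded_additive_eq.
- apply: (bounded_additive_comp bounded_additive_star).
  exact: bounded_additive_mulr.
- exact: (bounded_additive_comp (bounded_additive_mull (l1_mem_star am))
    bounded_additive_star).
move=> h t ht; have tm := l1_mem_delta ht; move: a am; apply: bounded_additive_eq.
- apply: (bounded_additive_comp bounded_additive_star).
  exact: bounded_additive_mull.
- exact: (bounded_additive_comp (bounded_additive_mulr (l1_mem_star tm))
    bounded_additive_star).
move=> g s gs; rewrite l1_mul_delta// !l1_star_delta l1_mul_delta;
  try exact: (homog_star act).
by rewrite (twist_star tot act tr) opprD addrC.
Qed.

(** * The unit *)

Lemma l1_oneE : @l1_one R A G = delta 0 (cs_one A).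
Proof. by []. Qed.

Lemma homog_one : homog alpha 0 (cs_one A).
Proof. by apply/homogP; rewrite oppr0 pospart0 alpha0// cs_mul1l. Qed.

Lemma l1_mul1l a : l1_mem alpha a -> l1_mul alpha L (@l1_one R A G) a = a.
Proof.
have one_mem := l1_mem_delta homog_one.
move: a; apply: bounded_additive_eq.
- exact: (bounded_additive_mulr one_mem).
- exact: bounded_additive_id.
move=> g s gs; rewrite l1_mul_delta ?add0r//; last exact: homog_one.
congr delta; have [g0|g0] := og_ge0_total tot g.
  by rewrite (twist_pospos tot act tr)// alpha0// cs_mul1l.
(* Reading the unit's degree as -0 makes both degrees negative; the resulting factor alpha_{-g}(1)
   is absorbed by homogeneity. *)
rewrite -{1}oppr0 -(opprK g) (twist_negneg tot act tr)//.
by have /homogP[+ _] := gs; rewrite pospart_id.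
Qed.

Lemma l1_star_one : l1_star (@l1_one R A G) = @l1_one R A G.
Proof. by rewrite l1_oneE l1_star_delta oppr0 cs_star1. Qed.

(** The left unit law transported by the involution, which fixes the unit. *)
Lemma l1_mul1r a : l1_mem alpha a -> l1_mul alpha L a (@l1_one R A G) = a.
Proof.
move=> am; rewrite -[LHS]l1_starK l1_starM//; last exact/l1_mem_delta/homog_one.
by rewrite l1_star_one l1_mul1l ?l1_starK//; exact: l1_mem_star.
Qed.

Lemma l1_norm_one : l1_norm (@l1_one R A G) = cs_norm (cs_one A).
Proof.
apply/eqP; rewrite eq_le (l1_norm_le (delta_bounded _ _)) /=.
by have := le_l1_norm 0 (l1_mem_delta homog_one); rewrite {1}/delta eqxx.
Qed.

End L1Algebra.

Theorem theorem4p3 (R : realType) (A : cstar_algebra R) (G : porderZmodType)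
    (alpha L : G -> A -> A) :
  totally_ordered_group G ->
  endo_semigroup_action alpha ->
  complete_transfer_action alpha L ->
  (forall a b : G -> A, l1_mem alpha a -> l1_mem alpha b -> l1_mul_defined alpha L a b) /\
  unital_banach_star_algebra [set a | l1_mem alpha a] (@l1_norm R A G)
    (l1_mul alpha L) (@l1_star R A G) (@l1_one R A G).
Proof.
move=> tot act tr; split.
  by move=> a b am bm k; case: (l1_mul_sum tot act tr k am bm).
split.
- split; split.
  + exact: l1_mem_fzero.
  + by move=> a b; exact: (l1_mem_fadd tot act).
  + by move=> z a; exact: (l1_mem_fscale tot act).
  + by move=> a; exact: (l1_norm_ge0 tot act).
  + by move=> a; exact: (l1_norm_eq0 tot act).
  + by move=> a b; exact: (l1_norm_fadd tot act).
  + by move=> z a; exact: (l1_norm_fscale tot act).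
- exact: (l1_complete tot act).
- split.
  + by move=> a b; exact: (l1_mem_mul tot act tr).
  + by move=> a b c; exact: (l1_mulA tot act tr).
  + by move=> a b c am bm cm; split; [exact: (l1_mulDl tot act tr)|exact: (l1_mulDr tot act tr)].
  + by move=> z a b am bm; split; [exact: (l1_mulZl tot act tr)|exact: (l1_mulZr tot act tr)].
  + by move=> a b; exact: (l1_norm_mul tot act tr).
- split.
  + by split=> a am; [exact: (l1_mem_star tot act)|exact: l1_starK].
  + by move=> a b _ _; exact: l1_starD.
  + by move=> z a _; apply/funext => g; rewrite /l1_star /fscale cs_starZ.
  + by move=> a b; exact: (l1_starM tot act tr).
  + by move=> a; exact: (l1_norm_star tot act).
- split.
  + exact/(l1_mem_delta tot act)/homog_one.
  + by move=> a am; split; [exact: (l1_mul1l tot act tr)|exact: (l1_mul1r tot act tr)].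
  + exact: (l1_norm_one tot act).
Qed.
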